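(* Let $\rho$ be a good perturbation function with associated smooth best response map $\mathbf{br}$, and let $(\beta_n)_{n\ge 1}$ be a nondecreasing sequence of positive real numbers with $\beta_n\to+\infty$ such that, for some $\nu<1$, $\beta_n\le n^{\nu}$ for all $n\ge 1$. Then the vanishingly smooth fictitious play strategy VSFP$(\beta_n)$ of player 1 induced by $(\beta_n)_n$ and $\mathbf{br}$ is consistent: for any strategy of nature (player 2), $$\limsup_{n\to\infty} e_n\le 0\quad \mathbb{P}\text{-almost surely}.$$
   Context: Game. $I$ and $L$ are finite nonempty sets (moves of player 1, the decision maker, and of player 2, nature); $\pi:I\times L\to\mathbb{R}$ is the payoff function of player 1. $X=\Delta(I)$, $Y=\Delta(L)$ are the simplices of probability vectors on $I$, $L$; $\pi$ is extended to $X\times Y$ bilinearly by $\pi(x,y)=\sum_{i,l}\pi(i,l)x_iy_l$. Pure moves are identified with vertices. $\Pi(y)=\max_{i\in I}\pi(i,y)$ for $y\in Y$. Play. $(\Omega,\mathcal{F},\mathbb{P})$ is a probability space with filtration $(\mathcal{F}_n)_n$. A strategy of player 1 (resp. nature) is an adapted process $(i_n)_{n\ge1}$ in $I$ (resp. $(l_n)_{n\ge1}$ in $L$). The players play independently: for all $n$, $i\in I$, $l\in L$, $\mathbb{P}(i_{n+1}=i,l_{n+1}=l\mid\mathcal{F}_n)=\mathbb{P}(i_{n+1}=i\mid\mathcal{F}_n)\,\mathbb{P}(l_{n+1}=l\mid\mathcal{F}_n)$. Put $\overline{y}_n=\frac1n\sum_{k=1}^n\delta_{l_k}\in Y$, $\overline{\pi}_n=\frac1n\sum_{k=1}^n\pi(i_k,l_k)$,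 and $e_n=\Pi(\overline{y}_n)-\overline{\pi}_n$ (average regret). Good perturbation function. Let $Int(X)$ be the relative interior of $X$, $\partial X$ its relative boundary and $TX=\{h\in\mathbb{R}^I:\sum_ih_i=0\}$. A good perturbation function is a $C^2$ function $\rho:Int(X)\to\mathbb{R}$ such that (1) there is $\lambda>0$ with $\langle D^2\rho(x)h,h\rangle\le-\lambda\|h\|^2$ for all $x\in Int(X)$, $h\in TX$; (2) $\|\nabla\rho(x)\|\to+\infty$ as $x\to\partial X$ (derivatives taken along $TX$). For $\beta>0$, $y\in Y$, the function $x\mapsto\pi(x,y)+\frac1\beta\rho(x)$ has a unique maximizer, which lies in $Int(X)$; it is denoted $\mathbf{br}(y,\beta)$ (smooth best response). VSFP$(\beta_n)$ is the strategy of player 1 given by $\mathbb{P}(i_{n+1}=i\mid\mathcal{F}_n)=\mathbf{br}(\overline{y}_n,\beta_n)_i$ for all $n\ge1$, $i\in I$ (the first move is arbitrary). *)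

(* Defs.v *)
From HB Require Import structures.
From mathcomp Require Import all_boot all_order all_algebra.
From mathcomp Require Import all_classical all_reals all_analysis.

Set Implicit Arguments.
Unset Strict Implicit.
Unset Printing Implicit Defensive.
Import Order.TTheory GRing.Theory Num.Theory.
Import numFieldNormedType.Exports.
Local Open Scope classical_set_scope.
Local Open Scope ring_scope.

Section Simplex.
Context {R : realType} {m : nat}.
Implicit Types (x y z h : 'rV[R]_m.+1).

Definition enorm h : R := Num.sqrt (\sum_i h 0 i ^+ 2).

Definition simplex : set 'rV[R]_m.+1 :=
  [set x | (forall i, 0 <= x 0 i) /\ \sum_i x 0 i = 1].

(* Interior relative to the affine hull of the simplex, which is the
   hyperplane of the vectors with coordinates summing to 1. *)
Definition simplex_int : set 'rV[R]_m.+1 :=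
  [set x | simplex x /\
     nbhs x [set z : 'rV[R]_m.+1 | \sum_i z 0 i = 1 -> simplex z]].

Definition simplex_bd : set 'rV[R]_m.+1 := simplex `\` simplex_int.

Definition tangent : set 'rV[R]_m.+1 := [set h | \sum_i h 0 i = 0].

(* Functions on the relative interior are represented by total functions.  Only
   directional derivatives along tangent vectors, at points of the relative
   interior, are used below, so values off the relative interior are
   irrelevant. *)
Definition C1_simplex (f : 'rV[R]_m.+1 -> R) : Prop :=
  forall h, tangent h ->
    (forall x, simplex_int x -> derivable f x h) /\
    {within simplex_int, continuous ('D_h f)}.

Definition C2_simplex (f : 'rV[R]_m.+1 -> R) : Prop :=
  C1_simplex f /\ forall h, tangent h -> C1_simplex ('D_h f).

(* The vector of [tangent] representing h |-> 'D_h f x on [tangent]: its i-th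
   coordinate is the derivative along the orthogonal projection of the i-th
   basis vector on [tangent]. *)
Definition grad (f : 'rV[R]_m.+1 -> R) x : 'rV[R]_m.+1 :=
  \row_i 'D_(delta_mx 0 i - const_mx (m.+1%:R^-1)) f x.

Definition good_perturbation (rho : 'rV[R]_m.+1 -> R) : Prop :=
  [/\ C2_simplex rho,
      exists2 lambda : R, 0 < lambda &
        forall x h, simplex_int x -> tangent h ->
          'D_h ('D_h rho) x <= - lambda * enorm h ^+ 2 &
      forall z, simplex_bd z ->
        enorm (grad rho x) @[x --> within simplex_int (nbhs z)] --> +oo].

End Simplex.

Section Game.
Context {R : realType} {m k : nat}.
Variable pi : 'I_m.+1 -> 'I_k.+1 -> R.

Definition payoff (x : 'rV[R]_m.+1) (y : 'rV[R]_k.+1) : R :=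
  \sum_i \sum_l pi i l * x 0 i * y 0 l.

Definition best_payoff (y : 'rV[R]_k.+1) : R :=
  \big[Num.max/payoff (delta_mx 0 ord0) y]_(i < m.+1) payoff (delta_mx 0 i) y.

(* [get] selects an element of the set of maximizers, which is a singleton
   when rho is a good perturbation function, 0 < beta and y is in the
   simplex. *)
Definition smooth_br (rho : 'rV[R]_m.+1 -> R) (y : 'rV[R]_k.+1) (beta : R) :
    'rV[R]_m.+1 :=
  get [set x | simplex_int x /\ forall z, simplex_int z ->
    payoff z y + beta^-1 * rho z <= payoff x y + beta^-1 * rho x].

Context {T : Type}.
Variables (i : nat -> T -> 'I_m.+1) (l : nat -> T -> 'I_k.+1).

Definition mean_action (n : nat) (w : T) : 'rV[R]_k.+1 :=
  n%:R^-1 *: \sum_(1 <= j < n.+1) delta_mx 0 (l j w).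

Definition mean_payoff (n : nat) (w : T) : R :=
  n%:R^-1 * \sum_(1 <= j < n.+1) pi (i j w) (l j w).

Definition regret (n : nat) (w : T) : R :=
  best_payoff (mean_action n w) - mean_payoff n w.

End Game.

Section Play.
Context {d : measure_display} {T : measurableType d} {R : realType}.
Variable P : probability T R.

Definition filtration (F : nat -> set (set T)) : Prop :=
  [/\ forall n, sigma_algebra setT (F n),
      forall n, F n `<=` measurable &
      forall n, F n `<=` F n.+1].

(* q is a version of P(A | G), for a sub-sigma-algebra G. *)
Definition is_cond_prob (G : set (set T)) (A : set T) (q : T -> R) : Prop :=
  [/\ measurable_fun setT (q : g_sigma_algebraType G -> R),
      P.-integrable setT (EFin \o q) &
      forall B, G B -> (\int[P]_(w in B) (q w)%:E)%E = P (A `&` B)].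

(* Adapted process with values in a finite set; as for strategies, the process
   is indexed from 1 and its value at time 0 is meaningless. *)
Definition adapted {I : finType} (F : nat -> set (set T)) (i : nat -> T -> I) :
    Prop :=
  forall n a, (1 <= n)%N -> F n [set w | i n w = a].

(* Conditional probabilities always exist and are a.s. unique, so asking for
   one pair of versions amounts to asking it for all of them. *)
Definition independent_play {I L : finType} (F : nat -> set (set T))
    (i : nat -> T -> I) (l : nat -> T -> L) : Prop :=
  forall n a b, exists p q : T -> R,
    [/\ is_cond_prob (F n) [set w | i n.+1 w = a] p,
        is_cond_prob (F n) [set w | l n.+1 w = b] q &
        is_cond_prob (F n) [set w | i n.+1 w = a /\ l n.+1 w = b]
          (fun w => p w * q w)].

Definition VSFP {m k : nat} (pi : 'I_m.+1 -> 'I_k.+1 -> R)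
    (rho : 'rV[R]_m.+1 -> R) (beta : nat -> R) (F : nat -> set (set T))
    (i : nat -> T -> 'I_m.+1) (l : nat -> T -> 'I_k.+1) : Prop :=
  forall n a, (1 <= n)%N ->
    is_cond_prob (F n) [set w | i n.+1 w = a]
      (fun w => smooth_br pi rho (mean_action l n w) (beta n) 0 a).

End Play.

(* Main.v *)
Require Import Defs.
From HB Require Import structures.
From mathcomp Require Import all_boot all_order all_algebra.
From mathcomp Require Import all_classical all_reals all_analysis.
From mathcomp Require Import measurable_realfun lra ring zify.

Set Implicit Arguments.
Unset Strict Implicit.
Unset Printing Implicit Defensive.
Import Order.TTheory GRing.Theory Num.Theory.
Import numFieldNormedType.Exports.
Local Open Scope classical_set_scope.
Local Open Scope ring_scope.

(* Let U_n(y) be the supremum over the interior of the simplex of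
   payoff x y + (rho x - M) / beta_n, and x_n the smooth best response at time n.
   Strong concavity of rho gives
     (n+1) U_(n+1)(y_(n+1)) <= n U_n(y_n) + payoff x_n l_(n+1) + O(beta_n / n)
                               + (n+1) (U_(n+1) - U_n)(y_(n+1)).
   The differences payoff x_n l_(n+1) - pi i_(n+1) l_(n+1) are orthogonal and
   bounded, so their averages vanish almost surely (second moments and
   Borel-Cantelli along squares), and U_n converges uniformly to the best payoff.

   The difficulty is the last term, since rho may be unbounded and beta may jump:
   sup_y (U_(n+1) - U_n)(y) need not be summable over a dyadic block. What saves
   the proof is that y_n moves by O(1/n) only. For concave functions b_t
   increasing with t, the increases of sup_x (<p, x> + b_t x) observed along a
   moving point p add up to at most kappa * (length of the path) + C(kappa) * om,
   where om bounds the total increase at each visited point. This is proved by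
   induction on the dimension. Let Y be the scale at which the near-maximizers
   spread over a width w in the last coordinate. On a stretch of the path either
   the increase is large with respect to Y, and then one of finitely many slices
   increases by a comparable amount; or the path is long with respect to Y and,
   by concavity, all its maximizers lie in a thin slab. In both cases one
   coordinate disappears. *)

(** * Increases of an optimal value along a path *)

Local Ltac nat_lia :=
  repeat match goal with
  | H : is_true (leq _ _) |- _ => revert H
  | H : is_true (andb (leq _ _) _) |- _ => revert H
  | H : @eq nat _ _ |- _ => revert H
  | H : is_true (negb _) |- _ => revert H
  end; clear; intros; lia.

Section Potential.
Context {R : realType} {V : lmodType R} (phi : nat -> V -> R).
Implicit Types (E : set V) (q : nat) (kappa C om th w u : R).

Definition segment_closed E := forall x y t, E x -> E y -> 0 <= t <= 1 ->
  E ((1 - t) *: x + t *: y).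

Definition concave_on E (b : V -> R) := forall x y t, E x -> E y -> 0 <= t <= 1 ->
  (1 - t) * b x + t * b y <= b ((1 - t) *: x + t *: y).

Definition phi_affine := forall i x y t,
  phi i ((1 - t) *: x + t *: y) = (1 - t) * phi i x + t * phi i y.

(** [V] stays fixed and only the first [q] coordinates carry a price, so the induction on the
    dimension can move a coordinate into [b] or freeze it. *)
Definition score q (g : nat -> R) (b : V -> R) x := \sum_(i < q) phi i x * g i + b x.

Definition top q E g b := sup [set score q g b x | x in E].

Definition dist1 q (g g' : nat -> R) := \sum_(i < q) `|g i - g' i|.

Definition path_len q (p : nat -> nat -> R) a c :=
  \sum_(a <= j < c) dist1 q (p j) (p j.+1).

(** Monotonicity is asked only up to [J], so that stretches of the path and subsequences of times
    form new processes. *)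
Definition value_process E (b : nat -> V -> R) (J : nat) :=
  [/\ E !=set0, segment_closed E,
      (forall i x, E x -> 0 <= phi i x <= 1),
      (forall t, concave_on E (b t)) &
      (forall t x, (t < J)%N -> E x -> b t x <= b t.+1 x) /\
      (forall t, exists B, forall x, E x -> b t x <= B)].

Lemma process_le E (b : nat -> V -> R) J : value_process E b J ->
  forall t t' x, (t <= t')%N -> (t' <= J)%N -> E x -> b t x <= b t' x.
Proof.
move=> [_ _ _ _ [bm _]] t t' x tt'; elim: t' tt' => [|t' IH].
  by rewrite leqn0 => /eqP ->.
rewrite leq_eqVlt => /orP[/eqP -> //|]; rewrite ltnS => tt' t'J Ex.
exact: le_trans (IH tt' (ltnW t'J) Ex) (bm _ _ t'J Ex).
Qed.

Lemma dist1_ge0 q g g' : 0 <= dist1 q g g'.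
Proof. by apply: sumr_ge0. Qed.

Lemma dist1C q g g' : dist1 q g g' = dist1 q g' g.
Proof. by apply: eq_bigr => i _; rewrite distrC. Qed.

Lemma dist1_triangle q g g' g'' :
  dist1 q g g'' <= dist1 q g g' + dist1 q g' g''.
Proof.
by rewrite -big_split; apply: ler_sum => i _; apply: ler_distD.
Qed.

Lemma dist1S q g g' : dist1 q.+1 g g' = dist1 q g g' + `|g q - g' q|.
Proof. by rewrite /dist1 big_ord_recr. Qed.

Lemma path_len_ge0 q p a c : 0 <= path_len q p a c.
Proof. by apply: sumr_ge0 => *; exact: dist1_ge0. Qed.

Lemma path_len_cat q p a c e : (a <= c)%N -> (c <= e)%N ->
  path_len q p a e = path_len q p a c + path_len q p c e.
Proof. by move=> ac ce; rewrite /path_len (big_cat_nat ac). Qed.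

Lemma path_lenS q p a c :  (a <= c)%N ->
  path_len q p a c.+1 = path_len q p a c + dist1 q (p c) (p c.+1).
Proof. by move=> ac; rewrite /path_len big_nat_recr. Qed.

Lemma path_len0 q p a : path_len q p a a = 0.
Proof. by rewrite /path_len big_geq. Qed.

Lemma path_lenW q p a c : path_len q p a c <= path_len q.+1 p a c.
Proof. by apply: ler_sum => j _; rewrite dist1S lerDl. Qed.

Lemma dist1_path q p a c : (a <= c)%N ->
  dist1 q (p a) (p c) <= path_len q p a c.
Proof.
elim: c => [|c IH]; first by rewrite leqn0 => /eqP ->;
  rewrite path_len0 /dist1 big1 // => i _; rewrite subrr normr0.
rewrite leq_eqVlt => /orP[/eqP ->|]; first by
  rewrite path_len0 /dist1 big1 // => i _; rewrite subrr normr0.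
rewrite ltnS => ac; rewrite path_lenS //.
by apply: le_trans (dist1_triangle q _ (p c) _) _; rewrite lerD2r IH.
Qed.

Lemma path_len_sub q p a a' c' c : (a <= a')%N -> (a' <= c')%N -> (c' <= c)%N ->
  path_len q p a' c' <= path_len q p a c.
Proof.
move=> aa ac cc; rewrite (@path_len_cat _ _ a a' c) //; last exact: leq_trans cc.
by rewrite (@path_len_cat _ _ a' c' c) // addrCA lerDl addr_ge0 ?path_len_ge0.
Qed.

Lemma dist1_path_sub q p a s s' c : (a <= s <= c)%N -> (a <= s' <= c)%N ->
  dist1 q (p s) (p s') <= path_len q p a c.
Proof.
move=> /andP[as_ sc] /andP[as' s'c].
have [ss'|/ltnW s's] := leqP s s'.
  by apply: le_trans (dist1_path _ _ ss') _; exact: path_len_sub.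
by rewrite dist1C; apply: le_trans (dist1_path _ _ s's) _; exact: path_len_sub.
Qed.

Lemma scoreS q g (b : V -> R) x : score q.+1 g b x = score q g b x + phi q x * g q.
Proof. by rewrite /score big_ord_recr /= addrAC. Qed.

Lemma score_le q g (b b' : V -> R) x : b x <= b' x -> score q g b x <= score q g b' x.
Proof. by move=> bb; rewrite lerD2l. Qed.

Lemma score_dist q E g g' (b : V -> R) x : (forall i x, E x -> 0 <= phi i x <= 1) -> E x ->
  score q g b x <= score q g' b x + dist1 q g g'.
Proof.
move=> ph Ex; rewrite /score addrAC lerD2r -big_split /=; apply: ler_sum => i _.
have /andP[p0 p1] := ph i x Ex.
rewrite -lerBlDl -mulrBr; apply: le_trans (ler_norm _) _.
by rewrite normrM (ger0_norm p0) ler_piMl.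
Qed.

Lemma score_concave q E g b : phi_affine -> concave_on E b -> concave_on E (score q g b).
Proof.
move=> pa bc x y t Ex Ey t01.
have -> : score q g b ((1 - t) *: x + t *: y) =
  (1 - t) * (\sum_(i < q) phi i x * g i) + t * (\sum_(i < q) phi i y * g i) +
  b ((1 - t) *: x + t *: y).
  rewrite /score; congr (_ + _); rewrite !mulr_sumr -big_split /=.
  by apply: eq_bigr => i _; rewrite pa; ring.
rewrite /score; have := bc x y t Ex Ey t01; lra.
Qed.

(** * Optimal values of a process *)

Section Top.
Context (q : nat) (E : set V) (b : nat -> V -> R) (J : nat).
Hypothesis vp : value_process E b J.

Lemma has_sup_score g t : has_sup [set score q g (b t) x | x in E].
Proof.
have [[e Ee] _ ph _ [_ /(_ t)[B bB]]] := vp.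
split; first by exists (score q g (b t) e), e.
exists (\sum_(i < q) `|g i| + B) => _ [x Ex <-].
apply: lerD; last exact: bB.
apply: ler_sum => i _; apply: le_trans (ler_norm _) _.
have /andP[p0 p1] := ph i x Ex.
by rewrite normrM (ger0_norm p0) ler_piMl.
Qed.

Lemma top_ge g t x : E x -> score q g (b t) x <= top q E g (b t).
Proof. by move=> Ex; apply: sup_upper_bound (has_sup_score g t) _ _; exists x. Qed.

Lemma top_near g t e : 0 < e -> exists2 x, E x & top q E g (b t) - e < score q g (b t) x.
Proof.
by move=> e0; have [_ [x Ex <-] h] := sup_adherent e0 (has_sup_score g t); exists x.
Qed.

Lemma top_le g t c : (forall x, E x -> score q g (b t) x <= c) -> top q E g (b t) <= c.
Proof.
move=> h; apply: ge_sup; first by case: (has_sup_score g t).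
by move=> _ [x Ex <-]; exact: h.
Qed.

Lemma top_mono g t t' : (t <= t')%N -> (t' <= J)%N ->
  top q E g (b t) <= top q E g (b t').
Proof.
move=> tt t'J; apply: top_le => x Ex; apply: le_trans (top_ge g t' Ex).
exact/score_le/(process_le vp).
Qed.

Lemma top_dist g g' t : top q E g (b t) <= top q E g' (b t) + dist1 q g g'.
Proof.
have [_ _ ph _ _] := vp; apply: top_le => x Ex.
apply: le_trans (score_dist q g g' (b t) ph Ex) _.
by rewrite lerD2r top_ge.
Qed.

End Top.


(* The scores move along [p] while [b] increases in time: [rise] is the increase
   of the optimal value at time [j], seen from the current position [p j] and
   truncated at [om]. *)
Definition rise q E (b : nat -> V -> R) (p : nat -> nat -> R) om j :=
  Num.min (top q E (p j) (b j) - top q E (p j) (b j.-1)) om.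

(** The statement of the induction on [q]; [C] is uniform in the set, the process, the path and its
    duration. The hypothesis bounds what is gained at [p j] after time [j]; the gain from [j.-1] to
    [j] is bounded only by the truncation in [rise]. *)
Definition rise_bound q kappa C := forall E (b : nat -> V -> R) p J om, value_process E b J ->
  0 < om ->
  (forall j, (1 <= j <= J)%N ->
    top q E (p j) (b J) <= top q E (p j) (b j) + om) ->
  \sum_(1 <= j < J.+1) rise q E b p om j <= kappa * path_len q p 1 J + C * om.

(** Without coordinates the position is irrelevant: the rises after the first telescope to at most
    [om], and the first is truncated at [om]. *)
Lemma rise_bound0 kappa : 0 < kappa -> rise_bound 0 kappa 2.
Proof.
move=> k0 E b p J om vp om0 H.
have top0 g g' t : top 0 E g (b t) = top 0 E g' (b t).
  by congr sup; apply: eq_imagel => x _; rewrite /score !big_ord0.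
apply: (@le_trans _ _ (2 * om)); last first.
  by rewrite lerDr mulr_ge0 ?(ltW k0) ?path_len_ge0.
case: J vp H => [|J] vp H; first by rewrite big_geq // mulr_ge0 // ltW.
rewrite big_nat_recl // mulr2n mulrDl mul1r lerD ?ge_min ?lexx ?orbT //.
apply: (@le_trans _ _ (top 0 E (p 1%N) (b J.+1) - top 0 E (p 1%N) (b 1%N))); last first.
  by rewrite lerBlDl H.
rewrite -(telescope_sumr (fun j => top 0 E (p 1%N) (b j))) //.
apply: ler_sum => j _.
by rewrite /rise ge_min /= !(top0 (p j.+1) (p 1%N)) lexx.
Qed.

(* When all near-maximizers have q-th coordinate within [th] of [u0], that
   coordinate is absorbed in [b]; the correction [th * length] restores
   monotonicity in time. *)
Lemma slab_rise_bound q kappa C E b p J om (om0 : R) th (u0 : R) a c :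
  phi_affine -> rise_bound q kappa C -> value_process E b J ->
  (a < c <= J)%N -> 0 <= th -> 0 < om0 ->
  (forall s, (a < s <= c)%N -> exists2 e, 0 < e & forall x, E x ->
     top q.+1 E (p s) (b s) - e < score q.+1 (p s) (b s) x ->
     `|phi q x - u0| <= th) ->
  (forall s, (a < s <= c)%N ->
     top q.+1 E (p s) (b c) <= top q.+1 E (p s) (b s) + om0) ->
  (forall s, (a < s <= c)%N -> rise q.+1 E b p om s <= om0) ->
  \sum_(a.+1 <= s < c.+1) rise q.+1 E b p om s <=
  kappa * path_len q p a.+1 c + C * (om0 + 2 * th * path_len q.+1 p a.+1 c).
Proof.
move=> pa RB vp /andP[ac cJ] th0 om00 Hnear Htop Hrise.
have [E0 Ec ph bc [bm bB]] := vp.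
pose E' : set V := [set x | E x /\ `|phi q x - u0| <= th].
(* Lengths are counted from [a.+1], so time 0 of the new process, which is time [a], uses the
   position [p a.+1]. *)
pose pos t := maxn (a + t) a.+1.
pose L := path_len q.+1 p a.+1.
(* The part [u0 * p q] of the removed term does not depend on [x] and is left out; the rest has a
   coefficient of size at most [th] on [E']. *)
pose b' t x := b (a + t)%N x + (phi q x - u0) * p (pos t) q + th * L (pos t).
pose p' t := p (a + t)%N.
have posE t : (0 < t)%N -> pos t = (a + t)%N by rewrite /pos; nat_lia.
have scoreE' g t x : score q g (b' t) x = score q.+1 g (b (a + t)%N) x - u0 * g q +
   (phi q x - u0) * (p (pos t) q - g q) + th * L (pos t).
  by rewrite scoreS /score /b'; ring.
have dq i j : `|p i q - p j q| <= dist1 q.+1 (p i) (p j).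
  by rewrite dist1S lerDr dist1_ge0.
have near s : (a < s <= c)%N -> forall e, 0 < e -> exists2 x, E' x &
    top q.+1 E (p s) (b s) - e < score q.+1 (p s) (b s) x.
  move=> sac e e0; have [e1 e10 He1] := Hnear s sac.
  have m0 : 0 < Num.min e e1 by rewrite lt_min e0.
  have [x Ex xt] := top_near q.+1 vp (p s) s m0; exists x.
    split=> //; apply: He1 => //; apply: le_lt_trans xt.
    by rewrite lerD2l lerN2 ge_min lexx orbT.
  by apply: le_lt_trans xt; rewrite lerD2l lerN2 ge_min lexx.
have vp' : value_process E' b' (c - a)%N.
  split.
  - have sac : (a < c <= c)%N by rewrite ac /=.
    by have [x Ex _] := near c sac 1 ltr01; exists x.
  - move=> x y t [Ex ux] [Ey uy] t01; split; first exact: Ec.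
    rewrite pa.
    have -> : (1 - t) * phi q x + t * phi q y - u0 =
      (1 - t) * (phi q x - u0) + t * (phi q y - u0) by ring.
    move: ux uy; rewrite !ler_norml; move/andP: t01 => [t0 t1].
    move=> /andP[? ?] /andP[? ?]; apply/andP; split; nra.
  - by move=> i x [Ex _]; exact: ph.
  - move=> t x y z [Ex _] [Ey _] z01.
    have := bc (a + t)%N x y z Ex Ey z01; rewrite /b' pa; lra.
  - split.
      move=> t x tca [Ex ux]; rewrite /b' addnS.
      have h1 : b (a + t)%N x <= b (a + t).+1 x by apply: bm => //; nat_lia.
      have [t0|t0] := posnP t.
        have -> : pos t.+1 = pos t by rewrite /pos; nat_lia.
        lra.
      have -> : pos t.+1 = (pos t).+1 by rewrite !posE // addnS.
      rewrite /L path_lenS; last by rewrite posE //; nat_lia.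
      have := dq (pos t) (pos t).+1; move: ux.
      set D := dist1 _ _ _; set x1 := phi q x - u0.
      set d1 := p (pos t) q; set d2 := p (pos t).+1 q.
      rewrite !ler_norml => /andP[? ?] /andP[? ?].
      have D0 : 0 <= D by exact: dist1_ge0.
      have : x1 * (d1 - d2) <= th * D; last lra.
      have [d12|d12] := leP 0 (d1 - d2); nra.
    move=> t; have [B BB] := bB (a + t)%N.
    exists (B + th * `|p (pos t) q| + th * L (pos t)) => x [Ex ux].
    rewrite /b' !lerD2r lerD ?BB //; apply: le_trans (ler_norm _) _.
    by rewrite normrM ler_pM.
(* Seen from another position, the slab gains at most [th] times the displacement over the full set;
   at its own position ([topL]) it loses nothing, as it contains the near-maximizers. *)
have topU s t : top q E' (p s) (b' t) <= top q.+1 E (p s) (b (a + t)%N) -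
    u0 * p s q + th * `|p (pos t) q - p s q| + th * L (pos t).
  apply: (top_le vp') => x [Ex ux]; rewrite scoreE' !lerD2r lerD //.
    by rewrite lerD2r (top_ge q.+1 vp).
  by apply: le_trans (ler_norm _) _; rewrite normrM ler_wpM2r.
have topL t : (0 < t)%N -> (a + t <= c)%N ->
    top q.+1 E (p' t) (b (a + t)%N) - u0 * p' t q + th * L (a + t)%N <=
    top q E' (p' t) (b' t).
  move=> t0 tc; apply/ler_addgt0Pr => e e0.
  have sac : (a < a + t <= c)%N by nat_lia.
  have [x E'x xt] := near _ sac e e0.
  have := top_ge q vp' (p' t) t E'x; rewrite scoreE' posE // /p' subrr mulr0.
  by move: xt; lra.
(* One [th * length] pays for the displacement of the position, the other for the growth of the
   correction. *)
set om' := om0 + 2 * th * path_len q.+1 p a.+1 c.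
have L0 : 0 <= path_len q.+1 p a.+1 c by exact: path_len_ge0.
have thL0 : 0 <= th * path_len q.+1 p a.+1 c by exact: mulr_ge0.
have om'0 : 0 < om' by rewrite /om'; lra.
have := RB E' b' p' (c - a)%N om' vp' om'0.
have -> : path_len q p' 1 (c - a) = path_len q p a.+1 c.
  rewrite /path_len -[a.+1]add1n big_addn.
  by apply: eq_bigr => j _; rewrite /p' addnS ![(_ + a)%N]addnC.
have -> : \sum_(a.+1 <= s < c.+1) rise q.+1 E b p om s =
   \sum_(1 <= t < (c - a).+1) rise q.+1 E b p om (a + t)%N.
  rewrite -[a.+1]add1n big_addn subSn; last exact: ltnW.
  by apply: eq_bigr => j _; rewrite addnC.
move=> RBH; apply: le_trans (RBH _); last first.
  move=> t /andP[t0 tc].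
  have tc' : (a + t <= c)%N by nat_lia.
  have sac : (a < a + t <= c)%N by nat_lia.
  have := topU (a + t)%N (c - a)%N; have := topL t t0 tc'; have := Htop _ sac.
  rewrite /p' posE ?subn_gt0 // subnKC; last exact: ltnW.
  have l1 : L (a + t)%N <= path_len q.+1 p a.+1 c.
    by apply: path_len_sub => //; nat_lia.
  have l2 : `|p c q - p (a + t)%N q| <= path_len q.+1 p (a + t)%N c.
    by apply: le_trans (dq _ _) _; rewrite dist1C dist1_path.
  have l3 : path_len q.+1 p a.+1 c = L (a + t)%N + path_len q.+1 p (a + t) c.
    by rewrite -path_len_cat //; nat_lia.
  rewrite /om' -/(L c); set X := `|_|  in l2 *; move: l2 l3; rewrite -/(L c).
  set Y := path_len _ _ _ _ => XY LY.
  have : th * X <= th * (L c - L (a + t)%N) by rewrite ler_wpM2l // LY; lra.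
  have : 0 <= th * L (a + t)%N by rewrite mulr_ge0 // path_len_ge0.
  lra.
rewrite big_nat_cond [leRHS]big_nat_cond; apply: ler_sum => t.
rewrite andbT => /andP[t0 tc].
have tc' : (a + t <= c)%N by nat_lia.
have sac : (a < a + t <= c)%N by nat_lia.
rewrite [leRHS]/rise le_min; apply/andP; split; last first.
  by apply: le_trans (Hrise _ sac) _; rewrite /om' -mulrA; lra.
rewrite /rise ge_min; apply/orP; left.
have := topU (a + t)%N t.-1; have := topL t t0 tc'.
have -> : (a + t.-1 = (a + t).-1)%N by nat_lia.
(* For [t = 1] both values are seen from [p a.+1]; later, the growth of the correction covers the
   loss by displacement. *)
rewrite /p' /=; have [t1|t1] := leqP t 1.
  have -> : pos t.-1 = (a + t)%N by rewrite /pos; nat_lia.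
  by rewrite subrr normr0 mulr0; lra.
have -> : pos t.-1 = (a + t).-1 by rewrite posE; nat_lia.
have -> : L (a + t)%N = L (a + t).-1 + dist1 q.+1 (p (a + t).-1) (p (a + t)%N).
  rewrite -[in LHS](@prednK (a + t)) ?addn_gt0 ?t0 ?orbT // /L path_lenS ?prednK //.
    by rewrite addn_gt0 t0 orbT.
  by nat_lia.
have : th * `|p (a + t).-1 q - p (a + t)%N q| <=
   th * dist1 q.+1 (p (a + t).-1) (p (a + t)%N) by rewrite ler_wpM2l.
lra.
Qed.

(** * Spread of the near-maximizers in one coordinate *)

Definition spread_set q E (g : nat -> R) (b : V -> R) w : set R :=
  [set y | exists x1 x2, [/\ E x1, E x2, w <= phi q x2 - phi q x1,
     top q.+1 E g b - y <= score q.+1 g b x1 &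
     top q.+1 E g b - y <= score q.+1 g b x2]].

(** The tolerance at which near-maximizers start to spread over a width [w] in coordinate [q]: the
    scale of a position. *)
Definition spread q E (g : nat -> R) (b : V -> R) w : R :=
  inf (spread_set q E g b w).

Section Spread.
Context (q : nat) (E : set V) (b : nat -> V -> R) (J : nat) (w : R).
Hypothesis vp : value_process E b J.
Hypothesis wide : exists x1 x2, [/\ E x1, E x2 & w <= phi q x2 - phi q x1].

Lemma spread_set_lb g t : lbound (spread_set q E g (b t) w) 0.
Proof.
move=> y [x1 [x2 [E1 _ _ h _]]].
by have := top_ge q.+1 vp g t E1; lra.
Qed.

Lemma has_inf_spread g t : has_inf (spread_set q E g (b t) w).
Proof.
split; last by exists 0; exact: spread_set_lb.
have [x1 [x2 [E1 E2 x12]]] := wide.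
exists (`|top q.+1 E g (b t) - score q.+1 g (b t) x1| +
        `|top q.+1 E g (b t) - score q.+1 g (b t) x2|), x1, x2; split=> //.
  have := ler_norm (top q.+1 E g (b t) - score q.+1 g (b t) x1).
  have := normr_ge0 (top q.+1 E g (b t) - score q.+1 g (b t) x2); lra.
have := ler_norm (top q.+1 E g (b t) - score q.+1 g (b t) x2).
have := normr_ge0 (top q.+1 E g (b t) - score q.+1 g (b t) x1); lra.
Qed.

Lemma spread_ge0 g t : 0 <= spread q E g (b t) w.
Proof.
by apply: lb_le_inf; [case: (has_inf_spread g t)|exact: spread_set_lb].
Qed.

Lemma spread_attained g t e : 0 < e -> exists x1 x2,
  [/\ E x1, E x2, w <= phi q x2 - phi q x1,
     top q.+1 E g (b t) - (spread q E g (b t) w + e) <= score q.+1 g (b t) x1 &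
     top q.+1 E g (b t) - (spread q E g (b t) w + e) <= score q.+1 g (b t) x2].
Proof.
move=> e0.
have [y [x1 [x2 [E1 E2 x12 h1 h2]]] ye] := inf_adherent e0 (has_inf_spread g t).
exists x1, x2; split=> //.
  by apply: le_trans h1; rewrite lerD2l lerN2 ltW.
by apply: le_trans h2; rewrite lerD2l lerN2 ltW.
Qed.

Lemma spread_narrow g t y x1 x2 : y < spread q E g (b t) w -> E x1 -> E x2 ->
  top q.+1 E g (b t) - y <= score q.+1 g (b t) x1 ->
  top q.+1 E g (b t) - y <= score q.+1 g (b t) x2 ->
  `|phi q x2 - phi q x1| < w.
Proof.
move=> yl E1 E2 h1 h2; rewrite ltNge; apply/negP => wl.
suff : spread q E g (b t) w <= y by rewrite leNgt yl.
apply: ge_inf; first by exists 0; exact: spread_set_lb.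
have [d0|d0] := lerP 0 (phi q x2 - phi q x1).
  by rewrite ger0_norm // in wl; exists x1, x2.
by rewrite ltr0_norm // opprB in wl; exists x2, x1.
Qed.

(** Contract [x] towards [x0] by the factor [1 / (2 * K)]. By concavity the new point is within
    [3 / 4] of the spread below the optimum, so its coordinate is less than [w] away from that of
    [x0]; undoing the contraction gives the bound. *)
Lemma spread_narrow_scale g t (K : R) x0 x : phi_affine -> 0 < w -> 1 <= K ->
  0 < spread q E g (b t) w -> E x0 -> E x ->
  top q.+1 E g (b t) - spread q E g (b t) w / 4 <= score q.+1 g (b t) x0 ->
  top q.+1 E g (b t) - K * spread q E g (b t) w <= score q.+1 g (b t) x ->
  `|phi q x - phi q x0| <= 2 * K * w.
Proof.
move=> pa w0 K1 s0 Ex0 Ex h0 h.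
have [_ Ec _ bc _] := vp.
have K0 : 0 < K by exact: lt_le_trans K1.
set y := spread _ _ _ _ _ in s0 h0 h *; set T := top _ _ _ _ in h0 h.
pose th := (2 * K)^-1.
have thK : th * K = 2^-1 by rewrite /th; field; rewrite gt_eqF.
have th0 : 0 < th by rewrite invr_gt0 mulr_gt0.
have th1 : th <= 1 by rewrite /th invf_le1; lra.
have t01 : 0 <= th <= 1 by rewrite (ltW th0).
have := score_concave q.+1 g pa (bc t) Ex0 Ex t01.
set z := ((1 - th) *: x0 + th *: x); move=> hz.
have Ez : E z by exact: Ec.
have hlow : T - y * (3 / 4) <= score q.+1 g (b t) z.
  apply: le_trans hz.
  have a1 : (1 - th) * (T - y / 4) <= (1 - th) * score q.+1 g (b t) x0.
    by rewrite ler_wpM2l // subr_ge0.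
  have a2 : th * (T - K * y) <= th * score q.+1 g (b t) x.
    by rewrite ler_wpM2l // ltW.
  have a3 : th * (K * y) = y / 2 by rewrite mulrA thK; lra.
  have a4 : 0 <= th * y by rewrite mulr_ge0 ?ltW.
  lra.
have yy : y * (3/4) < y by lra.
have h0' : T - y * (3 / 4) <= score q.+1 g (b t) x0 by lra.
have := spread_narrow yy Ex0 Ez h0' hlow.
have -> : phi q z - phi q x0 = th * (phi q x - phi q x0) by rewrite /z pa; ring.
rewrite normrM gtr0_norm // => /ltW.
by rewrite -ler_pdivlMl // /th invrK mulrC [w * _]mulrC.
Qed.

End Spread.

Lemma last_failure (P : nat -> Prop) c : (forall a, (a < c)%N -> P a) \/
  exists2 a, (a < c)%N & ~ P a /\ forall a', (a < a' < c)%N -> P a'.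
Proof.
elim: c => [|c [IH|[a ac [nPa IH]]]]; first by left.
  have [Pc|nPc] := pselect (P c).
    by left=> a; rewrite ltnS leq_eqVlt => /orP[/eqP ->//|]; exact: IH.
  by right; exists c => //; split=> // a' /andP[? ?]; nat_lia.
have [Pc|nPc] := pselect (P c).
  right; exists a; first exact: ltnW.
  split=> // a' /andP[aa']; rewrite ltnS leq_eqVlt => /orP[/eqP ->//|a'c].
  by apply: IH; rewrite aa'.
by right; exists c => //; split=> // a' /andP[? ?]; nat_lia.
Qed.

Lemma exists_max_nat (f : nat -> R) a c : (a < c)%N ->
  exists2 s0, (a < s0 <= c)%N & forall s, (a < s <= c)%N -> f s <= f s0.
Proof.
elim: c => // c IH; rewrite ltnS leq_eqVlt => /orP[/eqP ->|/IH].
  by exists c.+1; [nat_lia|move=> s sc; have -> : s = c.+1 by nat_lia].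
move=> [s0 s0c Hs0]; have [h|h] := leP (f c.+1) (f s0).
  exists s0; first by nat_lia.
  move=> s; have [->//|sc ?] := eqVneq s c.+1.
  by apply: Hs0; nat_lia.
exists c.+1; first by nat_lia.
move=> s; have [->//|sc ?] := eqVneq s c.+1.
by apply: le_trans (ltW h); apply: Hs0; nat_lia.
Qed.

(** * Cutting the path into windows and events *)

Section Windows.
Context (q : nat) (kappa C M th w om : R).
Hypotheses (k0 : 0 < kappa) (C1 : 1 <= C) (pa : phi_affine).
Hypothesis RB : rise_bound q (kappa / 8) C.
(** The constants balance three costs: a length [M * Y] pays for [C * (2 * Y)] at the rate
    [kappa / 8]; the slab correction [C * (2 * th * length)] has the same rate; and points within
    [(3 + 2 * M) * Y] of the optimum, [Y] being the spread, fit in a slab of half-width [th]. *)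
Hypothesis Mdef : M = 16 * C / kappa.
Hypothesis thdef : th = kappa / (16 * C).
Hypothesis wdef : w = th / (2 * (3 + 2 * M)).
Hypothesis om0 : 0 < om.
Context (E : set V) (b : nat -> V -> R) (p : nat -> nat -> R) (J : nat).
Hypothesis vp : value_process E b J.
Hypothesis Htop : forall j, (1 <= j <= J)%N ->
  top q.+1 E (p j) (b J) <= top q.+1 E (p j) (b j) + om.
Hypothesis wide : exists x1 x2, [/\ E x1, E x2 & w <= phi q x2 - phi q x1].

Let C0 : 0 < C. Proof. exact: lt_le_trans C1. Qed.
Let M0 : 0 < M. Proof. by rewrite Mdef divr_gt0 ?mulr_gt0. Qed.
Let th0 : 0 < th. Proof. by rewrite thdef divr_gt0 ?mulr_gt0. Qed.
Let w0 : 0 < w. Proof. rewrite wdef divr_gt0 // mulr_gt0 //; have := M0; lra. Qed.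
Let CM : C * 2 = kappa / 8 * M.
Proof. by rewrite Mdef; field; rewrite gt_eqF. Qed.
Let Cth : C * (2 * th) = kappa / 8.
Proof. by rewrite thdef; field; rewrite gt_eqF. Qed.
Let wth : 2 * (3 + 2 * M) * w = th.
Proof. by rewrite wdef; field; rewrite gt_eqF //; have := M0; lra. Qed.

(** The gain is followed from [s.-1] to the end [c] of a window, so that it dominates [rise] at
    [s]. *)
Definition later_rise c s :=
  Num.min (top q.+1 E (p s) (b c) - top q.+1 E (p s) (b s.-1)) om.

Let Y c s := spread q E (p s) (b c) w.
Let len := path_len q.+1 p.

(** Conditions that put the near-maximizers of all positions of the window into one slab. *)
Definition window_ok a c s0 := [/\ (a < s0 <= c)%N,
  (forall s, (a < s <= c)%N -> Y c s <= Y c s0),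
  len a.+1 c <= M * Y c s0 &
  (forall s, (a < s <= c)%N -> later_rise c s <= 2 * Y c s0)].

Lemma rise_le_later c s : (s <= c <= J)%N -> rise q.+1 E b p om s <= later_rise c s.
Proof.
move=> /andP[sc cJ]; rewrite /rise /later_rise le_min ge_min; apply/andP; split.
  by rewrite lerD2r (top_mono q.+1 vp).
by rewrite ge_min lexx orbT.
Qed.

(** Let [Y] be the scale at [s0]. A point within [Y] of the optimum at some position of the window
    is within [(3 + 2 * M) * Y] of the optimum at [s0] and time [c]: the change of time costs
    [2 * Y], the change of position twice the length. So [spread_narrow_scale] yields a slab around
    [x0]. *)
Lemma window_ok_bound a c s0 : (c <= J)%N -> window_ok a c s0 ->
  \sum_(a.+1 <= s < c.+1) rise q.+1 E b p om s <=
  kappa / 8 * len a.+1 c +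
  C * (Num.min (2 * Y c s0) om + 2 * th * len a.+1 c).
Proof.
move=> cJ [s0ac Ymax lenM Hr].
have len0 : 0 <= len a.+1 c by exact: path_len_ge0.
have Y0 : 0 <= Y c s0 by exact: (spread_ge0 vp wide).
have lth : 0 <= 2 * th * len a.+1 c by rewrite !mulr_ge0 // ltW.
have [Ypos|] := ltP 0 (Y c s0); last first.
  move=> Yn0; have {Yn0} YE : Y c s0 = 0 by apply/le_anti; rewrite Yn0.
  apply: (@le_trans _ _ 0); last first.
    have m0 : 0 <= Num.min (2 * Y c s0) om by rewrite le_min YE mulr0 lexx ltW.
    by rewrite addr_ge0 // mulr_ge0 ?(ltW C0) ?addr_ge0 // ltW // divr_gt0.
  rewrite big_nat_cond; apply: sumr_le0 => s; rewrite andbT => /andP[as_ sc].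
  have sac : (a < s <= c)%N by nat_lia.
  apply: le_trans (rise_le_later (_ : (s <= c <= J)%N)) _; first by nat_lia.
  by apply: le_trans (Hr _ sac) _; rewrite YE mulr0.
set om1 := Num.min (2 * Y c s0) om.
have om10 : 0 < om1 by rewrite lt_min om0 mulr_gt0.
(* [Htop] gives the bound [om]. For [2 * Y]: either the truncation in [later_rise] is inactive and
   the window condition applies, or it is active and [om <= 2 * Y]. *)
have topd s : (a < s <= c)%N ->
    top q.+1 E (p s) (b c) <= top q.+1 E (p s) (b s) + om1.
  move=> sac; have sJ : (1 <= s <= J)%N by nat_lia.
  have h1 : top q.+1 E (p s) (b c) <= top q.+1 E (p s) (b J).
    by apply: (top_mono q.+1 vp) => //; nat_lia.
  have h2 := Htop sJ.
  have h3 : top q.+1 E (p s) (b s.-1) <= top q.+1 E (p s) (b s).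
    by apply: (top_mono q.+1 vp) => //; nat_lia.
  have := Hr s sac; rewrite /later_rise /om1.
  rewrite !minEle; case: ifP => ?; case: ifP => ?; lra.
have K1 : 1 <= 3 + 2 * M by have := M0; lra.
have [x0 Ex0 hx0] : exists2 x, E x &
    top q.+1 E (p s0) (b c) - Y c s0 / 4 < score q.+1 (p s0) (b c) x.
  by apply: (top_near q.+1 vp); rewrite divr_gt0.
have ltc : (a < c)%N by nat_lia.
have slab : \sum_(a.+1 <= s < c.+1) rise q.+1 E b p om s <=
  kappa / 8 * path_len q p a.+1 c +
  C * (om1 + 2 * th * path_len q.+1 p a.+1 c).
  apply: (slab_rise_bound (u0 := phi q x0) pa RB vp) => //.
  - by rewrite ltc.
  - exact: ltW.
  - move=> s sac; exists (Y c s0) => // x Ex hx.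
    rewrite -wth; apply: (spread_narrow_scale vp pa w0 K1 Ypos Ex0 Ex).
      exact: ltW.
    have [_ _ ph _ _] := vp.
    have d1 := score_dist q.+1 (p s) (p s0) (b c) ph Ex.
    have d2 := top_dist q.+1 vp (p s0) (p s) c.
    have d3 : dist1 q.+1 (p s) (p s0) <= len a.+1 c by exact: dist1_path_sub.
    have d4 : score q.+1 (p s) (b s) x <= score q.+1 (p s) (b c) x.
      by apply: score_le; apply: (process_le vp) => //; nat_lia.
    have d5 := topd s sac; rewrite dist1C in d2.
    have d6 : om1 <= 2 * Y c s0 by rewrite /om1 ge_min lexx.
    rewrite -/(Y c s0); move: lenM d1 d2 d3 d4 d5 d6 hx.
    by rewrite mulrDl; lra.
  - move=> s sac; apply: le_trans (rise_le_later (_ : (s <= c <= J)%N)) _; first by nat_lia.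
    by rewrite /om1 le_min Hr //= /later_rise ge_min lexx orbT.
apply: le_trans slab _; rewrite lerD2r ler_wpM2l ?path_lenW //.
by rewrite ltW // divr_gt0.
Qed.

(* Cut the time interval backwards from [c]. The last window [a+1, c] is the
   longest one whose length and rises are controlled by the largest scale [Y] of
   its positions. If the rise at [a+1] breaks the control, it becomes an event;
   if the length does, the window is long with respect to [Y] and lies in a thin
   slab. *)
Lemma windows c : (c <= J)%N -> exists2 evs : seq (nat * nat),
  (forall ev, ev \in evs -> (0 < ev.1)%N /\ (ev.1 <= ev.2 <= c)%N /\
     2 * Y ev.2 ev.1 < later_rise ev.2 ev.1) /\
  pairwise (fun x y => (x.2 < y.1)%N) evs &
  \sum_(1 <= s < c.+1) rise q.+1 E b p om s <=
    kappa / 2 * len 1 c + C * om +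
    (2 + M) * \sum_(ev <- evs) later_rise ev.2 ev.1.
Proof.
have Com : 0 <= C * om by rewrite mulr_ge0 ?ltW.
elim/ltn_ind: c => -[|c] IH cJ.
  exists [::]; first by split.
  by rewrite !big_nil /len /path_len !big_geq // !mulr0 addr0 add0r.
set c1 := c.+1 in cJ *; pose P a := exists s0, window_ok a c1 s0.
have len0 a e : 0 <= len a e by exact: path_len_ge0.
(* [P a] concerns the positions from [a.+1] to [c1]. If it never fails, the whole interval is one
   window; otherwise [a] is the last failure and all shorter windows are sound. *)
have [H|[a ac [nP H]]] := last_failure P c1.
  have [s0 ok0] := H 0%N isT.
  exists [::]; first by split.
  have := window_ok_bound cJ ok0; rewrite big_nil mulr0 addr0.
  have : C * Num.min (2 * Y c1 s0) om <= C * om.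
    by rewrite ler_wpM2l ?(ltW C0) // ge_min lexx orbT.
  have : C * (2 * th * len 1 c1) = kappa / 8 * len 1 c1 by rewrite mulrA Cth.
  have : 0 <= kappa * len 1 c1 by rewrite mulr_ge0 // ltW.
  rewrite mulrDr; set X := C * Num.min _ _; set Y1 := C * (_ * _); lra.
have [s0 s0ac Ymax] := exists_max_nat (Y c1) ac.
have Y0 s : 0 <= Y c1 s by exact: (spread_ge0 vp wide).
have next s1 : window_ok a.+1 c1 s1 -> Y c1 s1 <= Y c1 s0.
  by move=> [s1ac _ _ _]; apply: Ymax; nat_lia.
(* First case: the rise at [a.+1] becomes an event, the recursion continues from [a], and the other
   rises up to [c1] are charged to the event. *)
have [Hev|Hev] := ltP (2 * Y c1 s0) (later_rise c1 a.+1).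
  have [evs [Hevs pw] Hs] := IH a ac (ltnW (leq_trans ac cJ)).
  have rise1 : rise q.+1 E b p om a.+1 <= later_rise c1 a.+1.
    by apply: rise_le_later; nat_lia.
  exists (rcons evs (a.+1, c1)).
    split.
      move=> ev; rewrite mem_rcons inE => /orP[/eqP -> /=|/Hevs]; last by case=> ? []; nat_lia.
      split=> //; split; first by nat_lia.
      by apply: le_lt_trans Hev; rewrite ler_pM2l //; apply: Ymax; nat_lia.
    rewrite pairwise_rcons pw andbT; apply/allP => ev /Hevs /=.
    by move=> [_ [? _]]; nat_lia.
  rewrite big_rcons /= -/(len) (@big_cat_nat _ _ _ a.+1) //=; last by nat_lia.
  rewrite [X in _ + X]big_nat_recl /=; last by nat_lia.
  have lena : len 1 a <= len 1 c1.
    by rewrite /len; case: (a) ac => [|a'] ?; [rewrite /path_len big_geq ?sumr_ge0 // => *; exact: dist1_ge0|apply: path_len_sub => //; nat_lia].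
  have : kappa / 2 * len 1 a <= kappa / 2 * len 1 c1.
    by rewrite ler_wpM2l // ltW // divr_gt0.
  suff : \sum_(a.+1 <= i < c1) rise q.+1 E b p om i.+1 <=
      (1 + M) * later_rise c1 a.+1 by lra.
  have [ac'|ac'] := ltnP a.+1 c1; last first.
    rewrite big_geq // mulr_ge0 //; first by have := M0; lra.
    by apply: le_trans (ltW Hev); rewrite mulr_ge0.
  have aac : (a < a.+1 < c1)%N by rewrite ltnSn.
have [s1 ok1] := H _ aac.
  have [s1ac _ lenM Hr] := ok1.
  (* Up to twice the length, the rises after [a.+1] telescope to the gain at [p a.+2]. That gain is
     at most [2 * Y] and the length at most [M * Y], while [2 * Y] is at most the event. *)
  have tel : \sum_(a.+1 <= i < c1) rise q.+1 E b p om i.+1 <=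
     top q.+1 E (p c1) (b c1) - top q.+1 E (p a.+2) (b a.+1) + len a.+2 c1.
    have : forall e, (a.+1 < e)%N -> \sum_(a.+1 <= i < e) rise q.+1 E b p om i.+1 <=
     top q.+1 E (p e) (b e) - top q.+1 E (p a.+2) (b a.+1) + len a.+2 e.
      elim=> // e IHe; rewrite ltnS leq_eqVlt => /orP[/eqP <-|ae].
        by rewrite big_nat1 /rise ge_min /len path_len0 addr0 lexx.
      rewrite big_nat_recr /=; last by nat_lia.
      rewrite /len path_lenS // -/(len).
      have := IHe ae.
      have : rise q.+1 E b p om e.+1 <=
         top q.+1 E (p e.+1) (b e.+1) - top q.+1 E (p e.+1) (b e).
        by rewrite /rise ge_min lexx.
      have := top_dist q.+1 vp (p e) (p e.+1) e.
      by rewrite /len; lra.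
    exact.
  have := top_dist q.+1 vp (p c1) (p a.+2) c1.
  have : dist1 q.+1 (p c1) (p a.+2) <= len a.+2 c1.
    by rewrite dist1C; apply: dist1_path; nat_lia.
  have aac2 : (a.+1 < a.+2 <= c1)%N by rewrite ltnSn.
  have Hr2 := Hr _ aac2.
  have := next _ ok1 => Y10.
  have lom : later_rise c1 a.+1 <= om by rewrite /later_rise ge_min lexx orbT.
  (* The truncation is inactive: otherwise [om <= 2 * Y c1 s1], which is less than the event, itself
     at most [om]. *)
  have Hr3 : top q.+1 E (p a.+2) (b c1) - top q.+1 E (p a.+2) (b a.+1) <=
     2 * Y c1 s1.
    by move: Hr2; rewrite /later_rise /= minEle; case: ifP => // ? ?; lra.
  have lenM' : 2 * len a.+2 c1 <= M * later_rise c1 a.+1.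
    have : M * (2 * Y c1 s1) <= M * later_rise c1 a.+1.
      by rewrite ler_pM2l //; lra.
    lra.
  move: tel; lra.
(* Second case: the rise at [a.+1] is controlled. A window with one position has length zero and
   would be sound, so [a.+1] is not [c1]. *)
have ac' : (a.+1 < c1)%N.
  rewrite ltnNge; apply/negP => c1a; have c1E : a.+1 = c1 by nat_lia.
  apply: nP; exists s0; split=> //.
    by rewrite c1E /len path_len0 mulr_ge0 // ltW.
  by move=> s sac; have -> : s = a.+1 by nat_lia.
have aac : (a < a.+1 < c1)%N by rewrite ltnSn.
have [s1 ok1] := H _ aac.
have [evs [Hevs pw] Hs] := IH a.+1 ac' (ltnW (leq_trans ac' cJ)).
(* The later rises being controlled, the failure comes from the length, which then pays for the slab
   bound of the window starting at [a.+2]. *)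
have longpath : M * Y c1 s0 < len a.+1 c1.
  rewrite ltNge; apply/negP => lenM; apply: nP; exists s0; split=> //.
  move=> s sac; have [->//|sa] := eqVneq s a.+1.
  have [_ _ _ Hr] := ok1; apply: le_trans (Hr s _) _; first by nat_lia.
  by rewrite ler_pM2l // next.
exists evs.
  by split=> // ev /Hevs [? []]; nat_lia.
have ac2 : (a.+2 <= c1.+1)%N by exact: ltnW.
rewrite (@big_cat_nat _ _ _ a.+2) //=.
have := window_ok_bound cJ ok1.
have len1 : len a.+2 c1 <= len a.+1 c1 by apply: path_len_sub => //; nat_lia.
(* The step from [a.+1] to [a.+2] is counted with the window, whereas the recursion keeps the rise
   at [a.+1]. *)
have len2 : len 1 c1 = len 1 a.+1 + len a.+1 c1.
  by rewrite /len -path_len_cat //; nat_lia.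
have : C * Num.min (2 * Y c1 s1) om <= kappa / 8 * len a.+1 c1.
  apply: (@le_trans _ _ (C * 2 * Y c1 s1)).
    by rewrite -mulrA ler_wpM2l ?(ltW C0) // ge_min lexx.
  rewrite CM -mulrA ler_pM2l ?divr_gt0 //; apply: le_trans (ltW longpath).
  by rewrite ler_pM2l // next.
have : C * (2 * th * len a.+2 c1) = kappa / 8 * len a.+2 c1 by rewrite mulrA Cth.
have : kappa / 8 * len a.+2 c1 <= kappa / 8 * len a.+1 c1.
  by rewrite ler_pM2l ?divr_gt0.
have : 0 <= kappa * len a.+1 c1 by rewrite mulr_ge0 // ltW.
move: Hs; rewrite len2 !mulrDr.
set X := later_rise; lra.
Qed.


(** * Events seen in finitely many slices *)

Definition near_slice z (ev : nat * nat) := exists x, [/\ E x, phi q x = z &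
  top q.+1 E (p ev.1) (b ev.2) - 3 / 4 * later_rise ev.2 ev.1 <=
  score q.+1 (p ev.1) (b ev.2) x].

(** Let [r] be the later rise. The scale is below [r / 2], so two points [w] apart in coordinate [q]
    lie within [3 / 4 * r] of the optimum. A multiple of [w] falls between their coordinates, and by
    concavity the point of the segment above it is as good. *)
Lemma near_slice_exists (N : nat) s c : w^-1 < N%:R ->
  2 * Y c s < later_rise c s -> exists2 k, (k <= N)%N & near_slice (k%:R * w) (s, c).
Proof.
move=> wN Hr.
have r0 : 0 < later_rise c s.
  by apply: le_lt_trans Hr; rewrite mulr_ge0 // (spread_ge0 vp wide).
have r4 : 0 < later_rise c s / 4 by rewrite divr_gt0.
have [x1 [x2 [E1 E2 x12 h1 h2]]] := spread_attained vp wide (p s) c r4.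
have [_ Ec ph bc _] := vp.
have /andP[u10 u11] := ph q x1 E1; have /andP[u20 u21] := ph q x2 E2.
set u1 := phi q x1 in x12 u10 u11; set u2 := phi q x2 in x12 u20 u21.
have uw0 : 0 <= u1 / w by rewrite divr_ge0 // ltW.
have /andP[k1 k2] := truncn_itv uw0.
set k := Num.truncn (u1 / w) in k1 k2.
have wV : w^-1 * w = 1 by rewrite mulVf // gt_eqF.
have uV : u1 / w * w = u1 by rewrite divfK // gt_eqF.
have k1' : k%:R * w <= u1 by rewrite -[leRHS]uV ler_pM2r.
have k2' : u1 < k.+1%:R * w by rewrite -[ltLHS]uV ltr_pM2r.
exists k.+1.
  have : k%:R < N%:R :> R.
    apply: le_lt_trans wN; apply: le_trans k1 _.
    by rewrite ler_piMl // invr_ge0 ltW.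
  by rewrite ltr_nat.
set z := k.+1%:R * w in k2' *.
have zu2 : z <= u2 by rewrite /z -natr1 mulrDl mul1r; lra.
have d0 : 0 < u2 - u1 by lra.
pose t := (z - u1) / (u2 - u1).
have t01 : 0 <= t <= 1.
  by rewrite /t divr_ge0 ?ler_pdivrMr //=; lra.
exists ((1 - t) *: x1 + t *: x2); split; first exact: Ec.
  rewrite pa -/u1 -/u2 /t; field; rewrite gt_eqF //.
have := score_concave q.+1 (p s) pa (bc c) E1 E2 t01; apply: le_trans.
move: t01 => /andP[t0 t1]; rewrite /=.
set v1 := score _ _ _ _ in h1 *; set v2 := score _ _ _ _ in h2 *.
set T := top _ _ _ _ in h1 h2 *.
have : T - 3 / 4 * later_rise c s <= v1 by move: h1 Hr; rewrite /Y; lra.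
have : T - 3 / 4 * later_rise c s <= v2 by move: h2 Hr; rewrite /Y; lra.
set B := T - _; nra.
Qed.

(* A slice which is nearly optimal at the end of an event was raised by a fixed
   fraction of the event, so the events of a slice are rises of a process with
   one coordinate less. *)
Lemma slice_events_bound kappa2 C2 z evs : 0 < kappa2 -> 0 <= C2 ->
  rise_bound q kappa2 C2 ->
  (forall ev, ev \in evs -> (0 < ev.1)%N /\ (ev.1 <= ev.2 <= J)%N /\
     0 <= later_rise ev.2 ev.1) ->
  pairwise (fun x y => (x.2 < y.1)%N) evs ->
  (forall ev, ev \in evs -> near_slice z ev) ->
  \sum_(ev <- evs) later_rise ev.2 ev.1 <=
    4 * (kappa2 * len 1 J + C2 * (2 * om)).
Proof.
move=> k20 C20 RB2 Hev pw Hsl.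
pose K := size evs; pose nt := nth (0%N, 0%N) evs.
have ntin k : (k < K)%N -> nt k \in evs by move=> ?; rewrite mem_nth.
have order i j : (i < j)%N -> (j < K)%N -> ((nt i).2 < (nt j).1)%N.
  move=> ij jK; move/(pairwiseP (0%N, 0%N)): pw; apply => //; rewrite inE //.
  exact: ltn_trans jK.
have [/size0nil -> |K0] := posnP K.
  rewrite big_nil mulr_ge0 // addr_ge0 //; apply: mulr_ge0.
  - exact: ltW.
  - exact: path_len_ge0.
  - by [].
  - by rewrite mulr_ge0 // ltW.
pose E' : set V := [set x | E x /\ phi q x = z].
(* One time per event: [tau k] is the end of the [k]-th event, counted from 1, and [p' k] below is
   its starting position. *)
pose tau k := if k is k'.+1 then (nt k').2 else 0%N.
have tauJ k : (k <= K)%N -> (tau k <= J)%N.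
  by case: k => // k kK; have [_ [/andP[]]] := Hev _ (ntin k kK).
have tau_mono k : (k < K)%N -> (tau k <= tau k.+1)%N.
  case: k => // k kK; have := order k k.+1 (ltnSn k) kK.
  by have [_ [/andP[? ?] _]] := Hev _ (ntin _ kK); rewrite /tau; nat_lia.
pose b' k := b (tau k); pose p' k := p (nt k.-1).1.
have [_ Ec ph bc [bm bB]] := vp.
have vp' : value_process E' b' K.
  split.
  - have [x [Ex xz _]] := Hsl _ (ntin 0%N K0); by exists x.
  - move=> x y t [Ex xz] [Ey yz] t01; split; first exact: Ec.
    by rewrite pa xz yz; ring.
  - by move=> i x [Ex _]; exact: ph.
  - by move=> t x y u [Ex _] [Ey _]; exact: bc.
  - split=> [t x tK [Ex _]|t]; last first.
      by have [B HB] := bB (tau t); exists B => x [Ex _]; exact: HB.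
    apply: (process_le vp) => //; first exact: tau_mono.
    exact: tauJ.
have score' s t x : E' x -> score q (p s) (b t) x = score q.+1 (p s) (b t) x - z * p s q.
  by move=> [_ xz]; rewrite scoreS xz; ring.
have topU s t : (t <= K)%N ->
    top q E' (p s) (b' t) <= top q.+1 E (p s) (b (tau t)) - z * p s q.
  move=> tK; apply: (top_le vp') => x E'x; rewrite score' // lerD2r.
  by apply: (top_ge q.+1 vp); case: E'x.
have topL k : (k < K)%N ->
    top q.+1 E (p (nt k).1) (b (nt k).2) - z * p (nt k).1 q -
      3 / 4 * later_rise (nt k).2 (nt k).1 <=
    top q E' (p' k.+1) (b' k.+1).
  move=> kK; have [x [Ex xz hx]] := Hsl _ (ntin k kK).
  have E'x : E' x by [].
  have := top_ge q vp' (p' k.+1) k.+1 E'x.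
  by rewrite /p' /= /b' score' //=; move: hx; lra.
have lr k : (k < K)%N -> later_rise (nt k).2 (nt k).1 <= om.
  by move=> _; rewrite /later_rise ge_min lexx orbT.
have lr' k : later_rise (nt k).2 (nt k).1 <=
   top q.+1 E (p (nt k).1) (b (nt k).2) - top q.+1 E (p (nt k).1) (b (nt k).1.-1).
  by rewrite /later_rise ge_min lexx.
(* After an event the slice is at most [3 / 4 * om] below the optimum at that position, which gains
   at most [om] afterwards; hence [2 * om]. *)
have om20 : 0 < 2 * om by rewrite mulr_gt0.
have main := RB2 E' b' p' K (2 * om) vp' om20 _.
have {main} main : \sum_(1 <= j < K.+1) rise q E' b' p' (2 * om) j <=
    kappa2 * path_len q p' 1 K + C2 * (2 * om).
  apply: main => -[//|k] /andP[_ kK].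
  have [s0 [/andP[sc cJ] r0]] := Hev _ (ntin k kK).
  have := topU (nt k).1 K (leqnn K); have := topL k kK; have := lr k kK.
  have : top q.+1 E (p (nt k).1) (b (tau K)) <= top q.+1 E (p (nt k).1) (b J).
    by apply: (top_mono q.+1 vp) => //; exact: tauJ.
  have : top q.+1 E (p (nt k).1) (b J) <= top q.+1 E (p (nt k).1) (b (nt k).1) + om.
    by apply: Htop; nat_lia.
  have : top q.+1 E (p (nt k).1) (b (nt k).1) <= top q.+1 E (p (nt k).1) (b (nt k).2).
    by apply: (top_mono q.+1 vp).
  by rewrite /p' /=; lra.
have plen k : (k < K)%N -> path_len q p' 1 k.+1 <= path_len q p 1 (nt k).1.
  elim: k => [_|k IH kK]; first by rewrite path_len0 path_len_ge0.
  rewrite path_lenS //; apply: le_trans (_ : _ <= path_len q p 1 (nt k).1 + path_len q p (nt k).1 (nt k.+1).1) _.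
    rewrite lerD ?IH //; first exact: ltnW.
    rewrite /p' /=; apply: dist1_path.
    have [_ [/andP[? ?] _]] := Hev _ (ntin k (ltnW kK)).
    by have := order k k.+1 (ltnSn k) kK; nat_lia.
  have [? [/andP[? ?] _]] := Hev _ (ntin k (ltnW kK)).
  have := order k k.+1 (ltnSn k) kK => ?.
  by rewrite -path_len_cat //; nat_lia.
have plenK : path_len q p' 1 K <= len 1 J.
  have KE : K = K.-1.+1 by rewrite prednK.
  have K1 : (K.-1 < K)%N by rewrite [ltnRHS]KE.
  have [? [/andP[? ?] _]] := Hev _ (ntin _ K1).
  rewrite KE; apply: le_trans (plen _ K1) _.
  by apply: le_trans (path_lenW _ _ _ _) _; apply: path_len_sub => //; nat_lia.
have -> : \sum_(ev <- evs) later_rise ev.2 ev.1 =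
    \sum_(1 <= j < K.+1) later_rise (nt j.-1).2 (nt j.-1).1.
  by rewrite (big_nth (0%N, 0%N)) big_add1.
have kl : kappa2 * path_len q p' 1 K <= kappa2 * len 1 J by rewrite ler_pM2l.
(* Before the event the slice is below the full optimum, and at its end at most [3 / 4] of the event
   below; so it rises by a quarter of the event. *)
suff : \sum_(1 <= j < K.+1) later_rise (nt j.-1).2 (nt j.-1).1 <=
    4 * \sum_(1 <= j < K.+1) rise q E' b' p' (2 * om) j by lra.
rewrite mulr_sumr big_nat_cond [leRHS]big_nat_cond; apply: ler_sum.
case=> [//|k]; rewrite andbT ltnS => /andP[_ kK] /=.
have [s0 [/andP[sc cJ] r0]] := Hev _ (ntin k kK).
rewrite /rise -ler_pdivrMl // mulrC le_min; apply/andP; split; last first.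
  by have := lr k kK; lra.
have := topL k kK; have := lr' k; have := topU (nt k).1 k (ltnW kK).
have : top q.+1 E (p (nt k).1) (b (tau k)) <= top q.+1 E (p (nt k).1) (b (nt k).1.-1).
  apply: (top_mono q.+1 vp); last by nat_lia.
  case: (k) kK => // k' kK; rewrite /tau.
  by have := order k' k'.+1 (ltnSn k') kK; nat_lia.
rewrite /p' /=; lra.
Qed.

End Windows.

(** * Induction on the number of coordinates *)

Lemma rise_boundW q kappa C C' : C <= C' -> rise_bound q kappa C ->
  rise_bound q kappa C'.
Proof.
move=> CC RB E b p J om vp om0 H; apply: le_trans (RB E b p J om vp om0 H) _.
by rewrite lerD2l ler_pM2r.
Qed.

(** The induction hypothesis serves twice: at rate [kappa / 8] on slabs, which fixes [C], [M], [th]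
    and [w], then at rate [kappa2] on the [N.+1] slices at multiples of [w]. Windows and events each
    spend [kappa / 2]. *)
Lemma rise_bound_exists q kappa : phi_affine -> 0 < kappa ->
  exists2 C, 0 <= C & rise_bound q kappa C.
Proof.
move=> pa; elim: q kappa => [|q IH] kappa k0.
  by exists 2 => //; exact: rise_bound0.
have [C' C'0 RB'] := IH (kappa / 8) (divr_gt0 k0 (ltr0n _ 8)).
pose C := C' + 1; have C1 : 1 <= C by rewrite /C; lra.
have C0 : 0 < C by rewrite /C; lra.
have RB : rise_bound q (kappa / 8) C by apply: rise_boundW RB'; rewrite /C; lra.
pose M := 16 * C / kappa; pose th := kappa / (16 * C).
pose w := th / (2 * (3 + 2 * M)).
have M0 : 0 < M by rewrite divr_gt0 ?mulr_gt0.
have th0 : 0 < th by rewrite divr_gt0 ?mulr_gt0.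
have w0 : 0 < w by rewrite divr_gt0 // mulr_gt0 //; lra.
pose N := (Num.truncn w^-1).+1.
have wN : w^-1 < N%:R.
  have wi : 0 <= w^-1 by rewrite invr_ge0 ltW.
  by have /andP[_] := truncn_itv wi.
pose D := 2 + M; have D0 : 0 < D by rewrite /D; lra.
(* Makes [4 * D * N.+1 * kappa2] equal to [kappa / 2]: [D] is the factor of the events in [windows],
   and 4 comes from [slice_events_bound]. *)
pose kappa2 := kappa / (8 * D * N.+1%:R).
have den0 : 0 < 8 * D * N.+1%:R :> R by rewrite !mulr_gt0.
have k20 : 0 < kappa2 by rewrite divr_gt0.
have [C2 C20 RB2] := IH kappa2 k20.
have Cth : C * (2 * th) = kappa / 8 by rewrite /th; field; rewrite gt_eqF.
exists (C + 8 * D * N.+1%:R * C2).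
  by rewrite addr_ge0 ?(ltW C0) // mulr_ge0 // ltW.
move=> E b p J om vp om0 Htop.
set len := path_len q.+1 p 1 J.
have len0 : 0 <= len by exact: path_len_ge0.
have klen0 : 0 <= kappa * len by rewrite mulr_ge0 // ltW.
have extra0 : 0 <= 8 * D * N.+1%:R * C2 * om.
  by rewrite mulr_ge0 ?(ltW om0) // mulr_ge0 // ltW.
(* If no two points are [w] apart in coordinate [q], the whole set is a slab, as [w <= th]. *)
have [wide|thin] := pselect (exists x1 x2, [/\ E x1, E x2 & w <= phi q x2 - phi q x1]);
  last first.
  case: J vp Htop @len len0 klen0 => [|J] vp Htop len len0 klen0.
    rewrite big_geq // addr_ge0 // mulr_ge0 ?(ltW om0) // addr_ge0 ?(ltW C0) //.
    by rewrite mulr_ge0 // ltW.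
  have [[x0 Ex0] _ _ _ _] := vp.
  have wth : w <= th.
    rewrite /w ler_pdivrMr; last by lra.
    by rewrite ler_peMr ?(ltW th0) //; lra.
  have := slab_rise_bound (u0 := phi q x0) (th := th) (om := om) (om0 := om) (a := 0%N)
    (c := J.+1) (p := p) pa RB vp.
  rewrite ltnSn /= => /(_ isT (ltW th0) om0) slab.
  have {}slab : \sum_(1 <= s < J.+2) rise q.+1 E b p om s <=
    kappa / 8 * path_len q p 1 J.+1 + C * (om + 2 * th * path_len q.+1 p 1 J.+1).
    apply: slab => [s _|s sJ|s _].
    - exists 1 => // x Ex _; apply: le_trans wth; rewrite ler_norml.
      have h1 : phi q x - phi q x0 < w.
        by rewrite ltNge; apply/negP => h; apply: thin; exists x0, x.
      have h2 : phi q x0 - phi q x < w.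
        by rewrite ltNge; apply/negP => h; apply: thin; exists x, x0.
      by apply/andP; split; lra.
    - exact: Htop.
    - by rewrite /rise ge_min lexx orbT.
  apply: le_trans slab _; rewrite -/len.
  have : kappa / 8 * path_len q p 1 J.+1 <= kappa / 8 * len.
    by rewrite ler_pM2l ?divr_gt0 // path_lenW.
  have : C * (2 * th * len) = kappa / 8 * len by rewrite mulrA Cth.
  by rewrite mulrDr mulrDl; lra.
have [evs [Hev pw]] := windows k0 C1 pa RB erefl erefl erefl om0 vp Htop wide (leqnn J).
rewrite -/len => Hsum; apply: le_trans Hsum _.
have pos ev : ev \in evs -> 0 <= later_rise q om E b p ev.2 ev.1.
  move=> /Hev [_ [_]] h; apply: le_trans (ltW h).
  by rewrite mulr_ge0 // (spread_ge0 vp wide).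
have [f Hf] : {f : nat * nat -> nat & forall ev, ev \in evs ->
    (f ev <= N)%N /\ near_slice q om E b p ((f ev)%:R * w) ev}.
  apply: (@choice _ _ (fun ev k => ev \in evs -> (k <= N)%N /\
     near_slice q om E b p (k%:R * w) ev)) => -[s c].
  have [/Hev [_ [_ h]]|_] := boolP ((s, c) \in evs); last by exists 0%N.
  by have [k kN sl] := near_slice_exists k0 C1 pa erefl erefl erefl vp wide wN h; exists k.
have bnd : \sum_(ev <- evs) later_rise q om E b p ev.2 ev.1 <=
    N.+1%:R * (4 * (kappa2 * len + C2 * (2 * om))).
  rewrite (partition_big (fun ev : nat * nat => inord (f ev) : 'I_N.+1) predT) //=.
  apply: (@le_trans _ _ (\sum_(k < N.+1) 4 * (kappa2 * len + C2 * (2 * om)))); last first.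
    by rewrite sumr_const card_ord -[leLHS]mulr_natl.
  apply: ler_sum => k _.
  rewrite -big_filter; apply: (slice_events_bound (z := (k : nat)%:R * w) pa om0 vp Htop k20 C20 RB2).
  - by move=> ev; rewrite mem_filter => /andP[_ evin];
      have [? [? _]] := Hev _ evin; split=> //; split=> //; exact: pos.
  - exact: pairwise_filter.
  - move=> ev; rewrite mem_filter => /andP[/eqP fk evin].
    have [fN sl] := Hf _ evin.
    by rewrite -fk inordK // ltnS.
have : (2 + M) * \sum_(ev <- evs) later_rise q om E b p ev.2 ev.1 <=
  D * (N.+1%:R * (4 * (kappa2 * len + C2 * (2 * om)))) by rewrite ler_pM2l.
have -> : D * (N.+1%:R * (4 * (kappa2 * len + C2 * (2 * om)))) =
  kappa / 2 * len + 8 * D * N.+1%:R * C2 * om.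
  have -> : kappa / 2 = 4 * D * N.+1%:R * kappa2.
    have N0 : 0 < N.+1%:R :> R by rewrite ltr0n.
    rewrite /kappa2; move: (D) D0 (N.+1%:R) N0 => D' D'0 X X0.
    by field; rewrite !gt_eqF.
  by ring.
rewrite [(C + _) * om]mulrDl; set S := (2 + M) * _; set X := 8 * D * _ * _ * _.
set Y := C * om; lra.
Qed.

End Potential.

(** * Strong concavity and the regret *)

Section StrongConcavity.
Context {R : realType}.

(** The chords over [0, t] and [t, 1] have slopes [f1 a] and [f1 c] with [a < t < c], and the mean
    value theorem for [f1] gives [f1 c <= f1 a]. *)
Lemma concave_of_derive2_le0 (f f1 f2 : R -> R) :
  (forall t : R, 0 <= t <= 1 -> is_derive t 1 f (f1 t)) ->
  (forall t : R, 0 <= t <= 1 -> is_derive t 1 f1 (f2 t)) ->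
  (forall t : R, 0 <= t <= 1 -> f2 t <= 0) ->
  forall t : R, 0 <= t <= 1 -> (1 - t) * f 0 + t * f 1 <= f t.
Proof.
move=> df df1 f20.
have mvt (g g' : R -> R) a c : 0 <= a -> a < c -> c <= 1 ->
    (forall t : R, 0 <= t <= 1 -> is_derive t 1 g (g' t)) ->
    exists2 d, a < d < c & g c - g a = g' d * (c - a).
  move=> a0 ac c1 dg.
  have dg' x : x \in `]a, c[ -> is_derive x 1 g (g' x).
    by rewrite in_itv /= => /andP[ax xc]; apply: dg; lra.
  have gc : {within `[a, c], continuous g}.
    apply: derivable_within_continuous => x; rewrite in_itv /= => /andP[ax xc].
    have x01 : 0 <= x <= 1 by lra.
    by have [] := dg x x01.
  by have [d] := MVT ac dg' gc; rewrite in_itv; exists d.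
move=> t /andP[t0 t1].
have [->|tn0] := eqVneq t 0; first by rewrite subr0 !mul1r mul0r addr0.
have [->|tn1] := eqVneq t 1; first by rewrite subrr mul0r mul1r add0r.
have tp : 0 < t by rewrite lt_neqAle eq_sym tn0.
have tl : t < 1 by rewrite lt_neqAle tn1.
have [a /andP[a0 at_] ea] := mvt f f1 0 t (lexx _) tp t1 df.
have [c /andP[tc c1] ec] := mvt f f1 t 1 t0 tl (lexx _) df.
have [d /andP[ad dc] ed] := mvt f1 f2 a c (ltW a0) (lt_trans at_ tc) (ltW c1) df1.
have f2d : f2 d <= 0 by apply: f20; lra.
have acd : f1 c <= f1 a by rewrite -subr_le0 ed mulr_le0_ge0 //; lra.
have : 0 <= t * (1 - t) * (f1 a - f1 c) by rewrite mulr_ge0 ?mulr_ge0 //; lra.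
have -> : f t = f 0 + f1 a * (t - 0) by rewrite -ea; ring.
have -> : f 1 = f 0 + f1 a * (t - 0) + f1 c * (1 - t) by rewrite -ec -ea; ring.
lra.
Qed.

Lemma is_derive_line (V : normedModType R) (f : V -> R) (x h : V) (t : R) :
  derivable f (x + t *: h) h ->
  is_derive t 1 (fun s => f (x + s *: h)) ('D_h f (x + t *: h)).
Proof.
move=> df.
have E : (fun s : R => s^-1 *: (f (x + (s *: (1 : R) + t) *: h) - f (x + t *: h))) =
         (fun s : R => s^-1 *: (f (s *: h + (x + t *: h)) - f (x + t *: h))).
  apply/funext => s; congr (_ *: (f _ - _)).
  by rewrite scalerDl /GRing.scale /= mulr1 addrCA.
split; first by rewrite /derivable /= E.
by rewrite /derive /= E.
Qed.

Context {m : nat}.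
Implicit Types x z h : 'rV[R]_m.+1.

Lemma sum_delta_row (n : nat) (j : 'I_n) :
  \sum_k (delta_mx 0 j : 'rV[R]_n) 0 k = 1.
Proof.
rewrite (bigD1 j) //= mxE !eqxx big1 ?addr0 // => k kj.
by rewrite mxE (negbTE kj) andbF.
Qed.

(** If coordinate [i] vanished, moving from [x] along the basis vector [j] minus the basis vector
    [i] would keep the sum equal to 1 and leave the simplex at once. *)
Lemma simplex_int_gt0 x i : simplex_int x -> 0 < x 0 i.
Proof.
move=> [[x0 x1] nx]; rewrite lt_neqAle x0 andbT eq_sym; apply/eqP => xi0.
have [j xj] : exists j, x 0 j != 0.
  apply/existsP; rewrite -negb_forall; apply/negP => /forallP H.
  move: x1; rewrite big1 => [/eqP|k _]; first by rewrite eq_sym oner_eq0.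
  exact/eqP.
pose h : 'rV[R]_m.+1 := delta_mx 0 j - delta_mx 0 i.
have ij : i != j by apply: contraNneq xj => <-; rewrite xi0.
have hcont : (fun t : R => x + t *: h) @ 0 --> x.
  rewrite -[X in _ --> X]addr0 -(scale0r h).
  by apply: cvgD; [exact: cvg_cst|apply: cvgZr_tmp; exact: cvg_id].
have := hcont _ nx; rewrite /= nbhs_simpl /= => /nbhs_ballP[e /= e0 He].
have := He (e / 2); rewrite /ball /= sub0r normrN gtr0_norm ?divr_gt0 //.
rewrite ltr_pdivrMr // ltr_pMr ?ltr1n // => /(_ isT).
case=> [|/(_ i)].
  rewrite (eq_bigr (fun k => x 0 k + e / 2 * h 0 k)); last by move=> k _; rewrite !mxE.
  rewrite big_split /= x1 -mulr_sumr.
  rewrite (eq_bigr (fun k => (delta_mx 0 j : 'rV[R]_m.+1) 0 k -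
    (delta_mx 0 i : 'rV[R]_m.+1) 0 k)); last first.
    by move=> k _; rewrite !mxE.
  by rewrite sumrB !sum_delta_row subrr mulr0 addr0.
by rewrite !mxE xi0 /= eqxx (negbTE ij) sub0r add0r mulrN1 oppr_ge0 leNgt divr_gt0.
Qed.

Lemma simplex_intP x : simplex_int x <-> (forall i, 0 < x 0 i) /\ \sum_i x 0 i = 1.
Proof.
split=> [xi|[x0 x1]].
  by split=> [i|]; [exact: simplex_int_gt0|case: xi => -[]].
split; first by split=> // i; exact: ltW.
have : nbhs x [set z : 'rV[R]_m.+1 | forall i, 0 < z 0 i].
  apply: (@filter_forall _ _ (fun i => [set z : 'rV[R]_m.+1 | 0 < z 0 i]) (nbhs x)).
  move=> i; have cc := @coord_continuous R 1 m.+1 0 i x.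
  exact: (cc _ (lt_nbhsr (x0 i))).
by apply: filterS => z z0 z1; split=> // i; exact: ltW.
Qed.

Lemma simplex_int_segment x z (t : R) : simplex_int x -> simplex_int z ->
  0 <= t <= 1 -> simplex_int ((1 - t) *: x + t *: z).
Proof.
move=> /simplex_intP[x0 x1] /simplex_intP[z0 z1] /andP[t0 t1].
apply/simplex_intP; split=> [i|].
  rewrite !mxE; have := x0 i; have := z0 i; nra.
rewrite (eq_bigr (fun i => (1 - t) * x 0 i + t * z 0 i)); last by move=> i _; rewrite !mxE.
by rewrite big_split /= -!mulr_sumr x1 z1 !mulr1 subrK.
Qed.

Lemma enorm_sqr h : enorm h ^+ 2 = \sum_i h 0 i ^+ 2.
Proof. by rewrite /enorm sqr_sqrtr // sumr_ge0 // => i _; exact: sqr_ge0. Qed.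

(** Along the segment, adding [c / 2 * s ^+ 2] to [rho] leaves a nonpositive second derivative, so
    the sum is concave. *)
Lemma good_perturbation_strong_concave (rho : 'rV[R]_m.+1 -> R) :
  good_perturbation rho ->
  exists2 lambda : R, 0 < lambda & forall x z (t : R),
    simplex_int x -> simplex_int z -> 0 <= t <= 1 ->
    (1 - t) * rho x + t * rho z + lambda / 2 * (t * (1 - t)) * enorm (z - x) ^+ 2 <=
    rho ((1 - t) *: x + t *: z).
Proof.
move=> [[C1 C2] [lambda l0 H] _]; exists lambda => // x z t xi zi t01.
set h := z - x; set c := lambda * enorm h ^+ 2.
have th : tangent h.
  move/simplex_intP: xi => [_ x1]; move/simplex_intP: zi => [_ z1].
  rewrite /tangent /= (eq_bigr (fun i => z 0 i - x 0 i)); last by move=> i _; rewrite !mxE.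
  by rewrite sumrB z1 x1 subrr.
have lineE s : (1 - s) *: x + s *: z = x + s *: h.
  by rewrite /h scalerBr scalerBl scale1r addrA addrAC.
have int (s : R) : 0 <= s <= 1 -> simplex_int (x + s *: h).
  by move=> s01; rewrite -lineE; exact: simplex_int_segment.
have d1 (s : R) : 0 <= s <= 1 -> is_derive s 1 (fun s : R => rho (x + s *: h)) ('D_h rho (x + s *: h)).
  by move=> s01; apply: is_derive_line; apply: (C1 h th).1; exact: int.
have d2 (s : R) : 0 <= s <= 1 ->
    is_derive s 1 (fun s : R => 'D_h rho (x + s *: h)) ('D_h ('D_h rho) (x + s *: h)).
  by move=> s01; apply: is_derive_line; apply: ((C2 h th) h th).1; exact: int.
have := @concave_of_derive2_le0 (fun s => rho (x + s *: h) + c / 2 * s ^+ 2)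
  (fun s => 'D_h rho (x + s *: h) + c * s)
  (fun s => 'D_h ('D_h rho) (x + s *: h) + c).
move=> /(_ _ _ _ t t01); rewrite lineE => conc.
suff : (1 - t) * (rho (x + 0 *: h) + c / 2 * 0 ^+ 2) +
    t * (rho (x + 1 *: h) + c / 2 * 1 ^+ 2) <= rho (x + t *: h) + c / 2 * t ^+ 2.
  by rewrite scale0r addr0 scale1r /h [x + _]addrC subrK -/h -/c; rewrite /c; lra.
apply: conc => s s01.
- have dq : is_derive s 1 (fun s : R => c / 2 * s ^+ 2) (c * s).
    by apply: is_derive_eq; rewrite /GRing.scale /=; field.
  exact: is_deriveD (d1 s s01) dq.
- have dl : is_derive s 1 (fun s : R => c * s) c.
    by apply: is_derive_eq; rewrite /GRing.scale /= mulr1.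
  exact: is_deriveD (d2 s s01) dl.
- by have := H _ h (int s s01) th; rewrite /c; lra.
Qed.

End StrongConcavity.

(** * Payoffs, coordinates and the mean action *)

Section SmoothRegret.
Context {R : realType} {m k : nat} (pi : 'I_m.+1 -> 'I_k.+1 -> R).
Implicit Types (x z e : 'rV[R]_m.+1) (y : 'rV[R]_k.+1).

Lemma payoff_lin (a c : R) x z y :
  payoff pi (a *: x + c *: z) y = a * payoff pi x y + c * payoff pi z y.
Proof.
rewrite /payoff !mulr_sumr -big_split; apply: eq_bigr => i _ /=.
rewrite !mulr_sumr -big_split; apply: eq_bigr => l _ /=.
by rewrite !mxE; ring.
Qed.

Lemma payoff_linr (a c : R) x y y' :
  payoff pi x (a *: y + c *: y') = a * payoff pi x y + c * payoff pi x y'.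
Proof.
rewrite /payoff !mulr_sumr -big_split; apply: eq_bigr => i _ /=.
rewrite !mulr_sumr -big_split; apply: eq_bigr => l _ /=.
by rewrite !mxE; ring.
Qed.

Lemma payoff_delta_l i y : payoff pi (delta_mx 0 i) y = \sum_l pi i l * y 0 l.
Proof.
rewrite /payoff (bigD1 i) //= [X in _ + X]big1 ?addr0.
  by apply: eq_bigr => l _; rewrite mxE !eqxx mulr1.
move=> j ji; rewrite big1 // => l _.
by rewrite mxE (negbTE ji) andbF mulr0 mul0r.
Qed.

Lemma payoffE x y : payoff pi x y = \sum_i x 0 i * payoff pi (delta_mx 0 i) y.
Proof.
apply: eq_bigr => i _; rewrite payoff_delta_l mulr_sumr.
by apply: eq_bigr => l _; ring.
Qed.

Lemma payoff_delta x l : payoff pi x (delta_mx 0 l) = \sum_i pi i l * x 0 i.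
Proof.
rewrite payoffE; apply: eq_bigr => i _; rewrite payoff_delta_l mulrC.
rewrite (bigD1 l) //= big1 ?addr0; first by rewrite mxE !eqxx mulr1.
by move=> j jl; rewrite mxE (negbTE jl) andbF mulr0.
Qed.

Definition payoff_bound : R := \sum_i \sum_l `|pi i l|.

Lemma payoff_bound_ge0 : 0 <= payoff_bound.
Proof. by apply: sumr_ge0 => i _; apply: sumr_ge0. Qed.

Lemma pi_bound i l : `|pi i l| <= payoff_bound.
Proof.
rewrite /payoff_bound (bigD1 i) //= (bigD1 l) //= -addrA lerDl.
by rewrite addr_ge0 ?sumr_ge0 // => j _; exact: sumr_ge0.
Qed.

Lemma simplex_le1 (n : nat) (u : 'rV[R]_n.+1) j : simplex u -> u 0 j <= 1.
Proof.
by move=> [u0 <-]; rewrite (bigD1 j) //= lerDl sumr_ge0.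
Qed.

Lemma delta_simplex (n : nat) (j : 'I_n.+1) : simplex (delta_mx 0 j : 'rV[R]_n.+1).
Proof. by split; [move=> i; rewrite mxE ler0n|exact: sum_delta_row]. Qed.

Lemma payoff_delta_bound i y : simplex y ->
  `|payoff pi (delta_mx 0 i) y| <= payoff_bound.
Proof.
move=> ys; rewrite payoff_delta_l.
apply: le_trans (ler_norm_sum _ _ _) _.
apply: (@le_trans _ _ (\sum_l `|pi i l|)).
  apply: ler_sum => l _; case: (ys) => y0 _; rewrite normrM (ger0_norm (y0 l)).
  by rewrite ler_piMr // simplex_le1.
by rewrite /payoff_bound [leRHS](bigD1 i) //= lerDl sumr_ge0 // => j _; exact: sumr_ge0.
Qed.

Lemma payoff_simplex_bound x y : simplex x -> simplex y ->
  `|payoff pi x y| <= payoff_bound.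
Proof.
move=> [x0 x1] ys; rewrite payoffE; apply: le_trans (ler_norm_sum _ _ _) _.
rewrite -[leRHS]mul1r -x1 mulr_suml; apply: ler_sum => j _.
by rewrite normrM (ger0_norm (x0 j)) ler_wpM2l // payoff_delta_bound.
Qed.

Lemma payoff_le_best i y : payoff pi (delta_mx 0 i) y <= best_payoff pi y.
Proof. exact: le_bigmax. Qed.

Lemma best_payoff_attained y :
  exists i, best_payoff pi y = payoff pi (delta_mx 0 i) y.
Proof.
rewrite /best_payoff.
apply: (big_ind (fun v => exists i, v = payoff pi (delta_mx 0 i) y)).
- by exists ord0.
- by move=> u v [i ->] [j ->]; rewrite maxEle; case: ifP => _; [exists j|exists i].
- by move=> i _; exists i.
Qed.

Lemma payoff_simplex_le_best x y : simplex x -> payoff pi x y <= best_payoff pi y.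
Proof.
move=> [x0 x1]; rewrite payoffE -[leRHS]mul1r -x1 mulr_suml.
by apply: ler_sum => i _; rewrite ler_wpM2l // payoff_le_best.
Qed.

(** Coordinates indexed by [nat], the shape that [score] expects; through [inord] every index
    denotes an actual move. *)
Definition ncoord (j : nat) x : R := x 0 (inord j).
Definition payoff_vec y (j : nat) : R := payoff pi (delta_mx 0 (inord j)) y.

Lemma ncoord_affine : phi_affine ncoord.
Proof. by move=> j x z t; rewrite /ncoord !mxE. Qed.

Lemma ncoord_simplex j x : simplex x -> 0 <= ncoord j x <= 1.
Proof. by move=> xs; rewrite simplex_le1 // andbT; case: xs => x0 _; exact: x0. Qed.

Lemma score_payoff y (b : 'rV[R]_m.+1 -> R) x :
  score ncoord m.+1 (payoff_vec y) b x = payoff pi x y + b x.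
Proof.
rewrite /score payoffE; congr (_ + _); apply: eq_bigr => i _.
by rewrite /ncoord /payoff_vec inord_val.
Qed.

Context {T : Type} (l : nat -> T -> 'I_k.+1) (w : T).
Let y n := mean_action l n w : 'rV[R]_k.+1.

Lemma mean_actionS n : (0 < n)%N -> n.+1%:R *: y n.+1 = n%:R *: y n + delta_mx 0 (l n.+1 w).
Proof.
move=> n0; rewrite /y /mean_action !scalerA !mulfV ?pnatr_eq0 -?lt0n // !scale1r.
by rewrite big_nat_recr.
Qed.

Lemma mean_action_simplex n : (0 < n)%N -> simplex (y n).
Proof.
move=> n0; have nR : 0 < n%:R :> R by rewrite ltr0n.
have sumE j : (\sum_(1 <= a < n.+1) delta_mx 0 (l a w) : 'rV[R]_k.+1) 0 j =
    \sum_(1 <= a < n.+1) (delta_mx 0 (l a w) : 'rV[R]_k.+1) 0 j by rewrite summxE.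
split=> [j|].
  rewrite mxE sumE mulr_ge0 ?invr_ge0 ?ler0n // sumr_ge0 // => a _.
  by rewrite mxE ler0n.
rewrite (eq_bigr (fun j => n%:R^-1 * \sum_(1 <= a < n.+1)
    (delta_mx 0 (l a w) : 'rV[R]_k.+1) 0 j)); last by move=> j _; rewrite mxE sumE.
rewrite -mulr_sumr exchange_big /=.
rewrite (eq_bigr (fun=> 1)); last by move=> a _; exact: sum_delta_row.
by rewrite sumr_const_nat subSS subn0 mulVf // gt_eqF.
Qed.

Lemma payoff_mean_actionS x n : (0 < n)%N ->
  payoff pi x (y n.+1) = payoff pi x (y n) +
    (payoff pi x (delta_mx 0 (l n.+1 w)) - payoff pi x (y n)) / n.+1%:R.
Proof.
move=> n0; have nR : n.+1%:R != 0 :> R by rewrite pnatr_eq0.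
have : payoff pi x (n.+1%:R *: y n.+1 + 0 *: y n) =
   payoff pi x (n%:R *: y n + 1 *: delta_mx 0 (l n.+1 w)).
  by rewrite scale0r addr0 scale1r mean_actionS.
rewrite !payoff_linr mul0r addr0 mul1r => h.
apply: (mulfI nR); rewrite h mulrDr mulrCA divff // -[n.+1]addn1 natrD; ring.
Qed.

Lemma payoff_vec_step n : (0 < n)%N ->
  dist1 m.+1 (payoff_vec (y n)) (payoff_vec (y n.+1)) <=
  m.+1%:R * (2 * payoff_bound) / n.+1%:R.
Proof.
move=> n0; rewrite /dist1.
apply: (@le_trans _ _ (\sum_(i < m.+1) 2 * payoff_bound / n.+1%:R)); last first.
  by rewrite sumr_const card_ord -[leLHS]mulr_natl mulrA.
apply: ler_sum => i _; rewrite /payoff_vec payoff_mean_actionS //.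
rewrite opprD addrA subrr sub0r normrN normrM normfV normr_nat.
rewrite ler_pM2r ?invr_gt0 ?ltr0n //; apply: le_trans (ler_normB _ _) _.
have h1 := payoff_delta_bound (inord i) (delta_simplex (l n.+1 w)).
have h2 := payoff_delta_bound (inord i) (mean_action_simplex n0).
by move: h1 h2; rewrite /y; lra.
Qed.

End SmoothRegret.

(** * Regret along one realized play *)

Section DeterministicRegret.
Context {R : realType} {m k : nat} (pi : 'I_m.+1 -> 'I_k.+1 -> R).
Context (rho : 'rV[R]_m.+1 -> R) (beta : nat -> R).
Hypothesis hrho : good_perturbation rho.
Hypothesis beta_gt0 : forall n, (1 <= n)%N -> 0 < beta n.
Hypothesis beta_nd : forall n p, (1 <= n)%N -> (n <= p)%N -> beta n <= beta p.
Hypothesis beta_oo : beta n @[n --> \oo] --> +oo.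
Context (M0 : R).
Hypothesis rhoM0 : forall e, simplex_int e -> rho e <= M0.

Let int_simplex (e : 'rV[R]_m.+1) : simplex_int e -> simplex e.
Proof. by case. Qed.

(** Subtracting the upper bound [M0] makes the perturbation nonpositive, hence nondecreasing in [n],
    as [beta] is. *)
Definition reg (n : nat) (e : 'rV[R]_m.+1) : R := (beta n)^-1 * (rho e - M0).

Definition smooth_value n (y : 'rV[R]_k.+1) : R :=
  top ncoord m.+1 simplex_int (payoff_vec pi y) (reg n).

Lemma simplex_int_exists : exists e : 'rV[R]_m.+1, simplex_int e.
Proof.
exists (const_mx (m.+1%:R^-1)); apply/simplex_intP; split=> [i|].
  by rewrite mxE invr_gt0 ltr0n.
rewrite (eq_bigr (fun=> m.+1%:R^-1)); last by move=> i _; rewrite mxE.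
by rewrite sumr_const card_ord -[LHS]mulr_natl divff // pnatr_eq0.
Qed.

Lemma rho_concave : concave_on simplex_int rho.
Proof.
have [lambda l0 H] := good_perturbation_strong_concave hrho.
move=> x z t xi zi t01; apply: le_trans (H x z t xi zi t01).
rewrite lerDl; apply: mulr_ge0; last exact: sqr_ge0.
move: t01 => /andP[t0 t1]; apply: mulr_ge0; first by rewrite ltW // divr_gt0.
by rewrite mulr_ge0 // subr_ge0.
Qed.

Lemma reg_process A J : (0 < A)%N ->
  value_process ncoord simplex_int (fun t => reg (A + t)) J.
Proof.
move=> A0; have b0 t : 0 < (beta (A + t)%N)^-1.
  by rewrite invr_gt0 beta_gt0 // addn_gt0 A0.
split.
- exact: simplex_int_exists.
- by move=> x z t; exact: simplex_int_segment.
- by move=> j e ei; apply: ncoord_simplex; exact: int_simplex.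
- move=> t x z s xi zi s01.
  have := rho_concave xi zi s01; rewrite -(ler_pM2l (b0 t)) /reg; lra.
- split=> [t e _ ei|t].
    rewrite /reg; have rM : rho e - M0 <= 0 by rewrite subr_le0 rhoM0.
    rewrite ler_wnM2r // lef_pV2 ?posrE ?beta_gt0 ?addn_gt0 ?A0 //.
    by apply: beta_nd; rewrite ?addn_gt0 ?A0 // leq_add2l.
  exists 0 => e ei; rewrite /reg pmulr_rle0 ?b0 // subr_le0.
  exact: rhoM0.
Qed.

Let reg_process1 n : (0 < n)%N -> value_process ncoord simplex_int (fun t => reg (n + t)) 0.
Proof. exact: reg_process. Qed.

Lemma smooth_value_ge n y e : (0 < n)%N -> simplex_int e ->
  payoff pi e y + reg n e <= smooth_value n y.
Proof.
move=> n0 ei; have := top_ge m.+1 (reg_process1 n0) (payoff_vec pi y) 0%N ei.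
by rewrite addn0 score_payoff.
Qed.

Lemma smooth_value_le n y c : (0 < n)%N ->
  (forall e, simplex_int e -> payoff pi e y + reg n e <= c) -> smooth_value n y <= c.
Proof.
move=> n0 H; have := @top_le _ _ ncoord m.+1 _ _ _ (reg_process1 n0) (payoff_vec pi y) 0%N c.
by rewrite addn0; apply => e ei; rewrite score_payoff H.
Qed.

Lemma smooth_value_le_best n y : (0 < n)%N -> smooth_value n y <= best_payoff pi y.
Proof.
move=> n0; apply: smooth_value_le => // e ei.
have h := payoff_simplex_le_best pi y (int_simplex ei).
have : reg n e <= 0.
  by rewrite /reg pmulr_rle0 ?invr_gt0 ?beta_gt0 // subr_le0 rhoM0.
lra.
Qed.

Lemma smooth_value_mono n y : (0 < n)%N -> smooth_value n y <= smooth_value n.+1 y.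
Proof.
move=> n0; have := top_mono m.+1 (reg_process 1 n0) (payoff_vec pi y) (leq0n 1) (leqnn 1).
by rewrite addn0 addn1.
Qed.

Lemma beta_large (B : R) : exists2 n0, (0 < n0)%N & forall n, (n0 <= n)%N -> B <= beta n.
Proof.
have /cvgryPge /(_ B) [n0 _ H] := beta_oo.
by exists n0.+1 => // n n0n; apply: H => /=; exact: ltnW.
Qed.

(** Since [rho] may be unbounded below, a vertex is replaced by its mixture [v i] with a fixed
    interior point, at a payoff cost of at most [2 * t * A]. There are finitely many mixtures, so
    one [K] bounds [M0 - rho] on all of them, and a large [beta] makes the perturbation small. *)
Lemma smooth_value_near_best eps : 0 < eps -> exists2 n0, (0 < n0)%N &
  forall n y, (n0 <= n)%N -> simplex y -> best_payoff pi y - eps <= smooth_value n y.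
Proof.
move=> e0; set A := payoff_bound pi.
have A0 : 0 <= A by exact: payoff_bound_ge0.
have [c ci] := simplex_int_exists.
pose t : R := eps / (4 * (A + 1) + eps).
have den : 0 < 4 * (A + 1) + eps by lra.
have t0 : 0 < t by rewrite divr_gt0.
have t1 : t < 1 by rewrite /t ltr_pdivrMr //; lra.
have tA : t * A <= eps / 4.
  rewrite /t mulrAC ler_pdivrMr //.
  have : 0 <= eps * eps by rewrite mulr_ge0 // ltW.
  lra.
pose v i : 'rV[R]_m.+1 := (1 - t) *: delta_mx 0 i + t *: c.
have vi i : simplex_int (v i).
  move/simplex_intP: (ci) => [c0 c1].
  apply/simplex_intP; split=> [j|].
    rewrite !mxE; have := mulr_gt0 t0 (c0 j).
    have : 0 <= (1 - t) * (((0 : 'I_1) == 0) && (j == i))%:R :> R.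
      by rewrite mulr_ge0 ?ler0n // subr_ge0 ltW.
    lra.
  rewrite (eq_bigr (fun j => (1 - t) * (delta_mx 0 i : 'rV[R]_m.+1) 0 j + t * c 0 j)).
    by rewrite big_split /= -!mulr_sumr c1 sum_delta_row !mulr1 subrK.
  by move=> j _; rewrite !mxE.
pose K : R := \sum_i (M0 - rho (v i)).
have K1 i : M0 - rho (v i) <= K.
  rewrite /K (bigD1 i) //= lerDl sumr_ge0 // => j _.
  by rewrite subr_ge0 rhoM0.
have K0 : 0 <= K by apply: le_trans (K1 ord0); rewrite subr_ge0 rhoM0.
have [n0 n00 Hn0] := beta_large ((K + 1) / (eps / 4)).
exists n0 => // n y n0n ys.
have n1 : (0 < n)%N by exact: leq_trans n0n.
have [i ->] := best_payoff_attained pi y.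
have h1 := smooth_value_ge y n1 (vi i).
have bn := beta_gt0 n1.
have h2 : - (eps / 4) <= reg n (v i).
  rewrite /reg lerNl -mulrN opprB mulrC ler_pdivrMr //.
  have := Hn0 _ n0n; rewrite ler_pdivrMr ?divr_gt0 // => h.
  by have := K1 i; lra.
have h3 : payoff pi (v i) y = (1 - t) * payoff pi (delta_mx 0 i) y + t * payoff pi c y.
  exact: payoff_lin.
have h4 := payoff_delta_bound pi i ys.
have h5 := payoff_simplex_bound pi (int_simplex ci) ys.
move: h4 h5; rewrite !ler_norml => /andP[a1 a2] /andP[a3 a4].
have h6 : t * payoff pi (delta_mx 0 i) y <= t * A by rewrite ler_pM2l.
have h7 : t * (- A) <= t * payoff pi c y by rewrite ler_pM2l.
by move: h1; rewrite h3; lra.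
Qed.

Context {T : Type} (l : nat -> T -> 'I_k.+1) (w : T).
Let y n := mean_action l n w : 'rV[R]_k.+1.

Definition value_jump n := smooth_value n.+1 (y n.+1) - smooth_value n (y n.+1).

Lemma value_jump_ge0 n : (0 < n)%N -> 0 <= value_jump n.
Proof. by move=> n0; rewrite subr_ge0 smooth_value_mono. Qed.

(** Apply [rise_bound] to at most [A] steps of length at most [C0 / A], that is, to a path of length
    at most [C0]. The order of choices matters: [kappa] according to [C0], then [C], then [om] with
    [C * om] small, then [A0] so that smooth values are within [om] of the best payoff. *)
Lemma value_jump_block eta : 0 < eta -> exists2 A0, (0 < A0)%N &
  forall A J, (A0 <= A)%N -> (J <= A)%N ->
    \sum_(A <= n < A + J) value_jump n <= eta.
Proof.
move=> eta0; pose C0 : R := m.+1%:R * (2 * payoff_bound pi).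
have C00 : 0 <= C0 by rewrite mulr_ge0 ?ler0n // mulr_ge0 // payoff_bound_ge0.
pose kappa := eta / (2 * (C0 + 1)).
have k0 : 0 < kappa by rewrite divr_gt0 // mulr_gt0 //; lra.
have [C Cge0 RB] := rise_bound_exists m.+1 (@ncoord_affine R m) k0.
pose om := eta / (2 * (C + 1)).
have om0 : 0 < om by rewrite divr_gt0 // mulr_gt0 //; lra.
have [A0 A00 HA0] := smooth_value_near_best om0.
exists A0 => // A J A0A JA.
have A1 : (0 < A)%N by exact: leq_trans A0A.
have nb n z : (A <= n)%N -> simplex z -> best_payoff pi z <= smooth_value n z + om.
  by move=> An zs; rewrite -lerBlDr; apply: HA0 => //; exact: leq_trans An.
have ys n : (0 < n)%N -> simplex (y n) by exact: mean_action_simplex.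
pose p t := payoff_vec pi (y (A + t)%N).
have := RB _ _ p J om (reg_process J A1) om0.
(* The rise at [j] is the jump of index [A + j - 1]; the truncation is inactive because both smooth
   values lie within [om] below the best payoff. *)
have -> : \sum_(1 <= j < J.+1) rise ncoord m.+1 simplex_int (fun t => reg (A + t)) p om j =
    \sum_(A <= n < A + J) value_jump n.
  rewrite big_add1 /= -[X in \sum_(X <= _ < _) value_jump _]add0n big_addn addKn.
  apply: eq_big_nat => j _; rewrite /rise /= /p [(j + A)%N]addnC.
  rewrite /value_jump /smooth_value addnS.
  rewrite min_l //; have s0 : simplex (y (A + j).+1) by exact: ys.
  have := smooth_value_le_best (y (A + j).+1) (ltn0Sn (A + j)).
  have := nb (A + j)%N _ (leq_addr _ _) s0.
  by rewrite /smooth_value; lra.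
move=> bound; apply: le_trans (bound _) _.
  move=> j /andP[j1 jJ]; have s0 : simplex (y (A + j)) by apply: ys; lia.
  apply: le_trans (nb (A + j)%N _ (leq_addr _ _) s0).
  by apply: smooth_value_le_best; rewrite addn_gt0 A1.
have C1 : C * om <= eta / 2.
  rewrite /om mulrA ler_pdivrMr; last by lra.
  have -> : eta / 2 * (2 * (C + 1)) = C * eta + eta by field.
  by rewrite lerDl ltW.
have pl : path_len m.+1 p 1 J <= C0.
  have AR : 0 < A%:R :> R by rewrite ltr0n.
  apply: (@le_trans _ _ (\sum_(1 <= j < J) C0 / A%:R)).
    apply: ler_sum => j _; rewrite /p addnS.
    apply: le_trans (payoff_vec_step _ _ _ _) _; first by rewrite addn_gt0 A1.
    rewrite -/C0 ler_wpM2l // lef_pV2 ?posrE ?ltr0n //.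
    by rewrite ler_nat ltnW // ltnS leq_addr.
  rewrite sumr_const_nat -[leLHS]mulr_natl mulrCA ler_piMr //.
  by rewrite ler_pdivrMr // mul1r ler_nat; apply: leq_trans JA; exact: leq_subr.
have : kappa * path_len m.+1 p 1 J <= eta / 2.
  apply: (@le_trans _ _ (kappa * C0)); first by rewrite ler_pM2l.
  rewrite /kappa mulrAC ler_pdivrMr; last by lra.
  have -> : eta / 2 * (2 * (C0 + 1)) = eta * C0 + eta by field.
  by rewrite lerDl ltW.
lra.
Qed.

(** On the upper half of the range the weights are at most [N] and the jumps add up to at most
    [eta]. The lower half ends at [a] with [2 * a <= N + 1], and
    [3 * eta * a + eta * N <= 3 * eta * N] once [3 <= N]. *)
Lemma weighted_jump_small eta : 0 < eta -> exists K : R, forall N,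
  \sum_(1 <= n < N) n.+1%:R * value_jump n <= K + 3 * eta * N%:R.
Proof.
move=> eta0; have [A0 A00 H] := value_jump_block eta0.
pose S N := \sum_(1 <= n < N) n.+1%:R * value_jump n.
have term0 n : (0 < n)%N -> 0 <= n.+1%:R * value_jump n.
  by move=> n0; rewrite mulr_ge0 ?ler0n // value_jump_ge0.
have S0 a c : (0 < a)%N -> 0 <= \sum_(a <= n < c) n.+1%:R * value_jump n.
  move=> a0; rewrite big_nat_cond; apply: sumr_ge0 => n.
  by rewrite andbT => /andP[an _]; apply: term0; exact: leq_trans an.
have Smono a c : (a <= c)%N -> S a <= S c.
  move=> ac; have [->|a0] := posnP a; first by rewrite /S big_geq // S0.
  by rewrite /S [leRHS](big_cat_nat a0 ac) lerDl S0.
pose N1 := (2 * A0 + 3)%N; exists (S N1) => N; rewrite -/(S N).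
elim/ltn_ind: N => N IH.
have [NN1|N1N] := leqP N N1.
  apply: le_trans (Smono _ _ NN1) _; rewrite lerDl !mulr_ge0 ?ler0n //.
  exact: ltW.
pose a := uphalf N.
have aN : (a < N)%N by rewrite /a; lia.
have a1 : (0 < a)%N by rewrite /a; lia.
have aA : (A0 <= a)%N by rewrite /a; lia.
have -> : S N = S a + \sum_(a <= n < N) n.+1%:R * value_jump n.
  by rewrite /S (big_cat_nat a1 (ltnW aN)).
have Na : (N - a <= a)%N by rewrite /a; lia.
have h1 : \sum_(a <= n < N) n.+1%:R * value_jump n <= N%:R * eta.
  apply: (@le_trans _ _ (N%:R * \sum_(a <= n < a + (N - a)) value_jump n)); last first.
    by rewrite ler_wpM2l ?ler0n // H.
  rewrite subnKC ?(ltnW aN) // mulr_sumr big_nat_cond [leRHS]big_nat_cond.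
  apply: ler_sum => n; rewrite andbT => /andP[an nN].
  rewrite ler_wpM2r ?ler_nat // value_jump_ge0 //; exact: leq_trans an.
have h2 := IH a aN.
have h3 : 2 * a%:R <= N%:R + 1 :> R.
  have : (2 * a <= N + 1)%N by rewrite /a; lia.
  by rewrite -(ler_nat R) natrM natrD.
have h4 : 3 <= N%:R :> R by rewrite ler_nat; lia.
nra.
Qed.


Definition smooth_maximizer n x := simplex_int x /\ forall z, simplex_int z ->
  payoff pi z (y n) + (beta n)^-1 * rho z <= payoff pi x (y n) + (beta n)^-1 * rho x.

Lemma smooth_value_maximizer n x : (0 < n)%N -> smooth_maximizer n x ->
  smooth_value n (y n) <= payoff pi x (y n).
Proof.
move=> n0 [xi xmax]; apply: smooth_value_le => // e ei.
have := xmax e ei; rewrite /reg.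
have : (beta n)^-1 * (rho x - M0) <= 0.
  by rewrite pmulr_rle0 ?invr_gt0 ?beta_gt0 // subr_le0 rhoM0.
rewrite !mulrBr; lra.
Qed.

(* Strong concavity isolates the maximizer quadratically, so by AM-GM a move of
   size O(1/n) of the mean action costs O(beta n / n^2) beyond first order. *)
Lemma smooth_value_step : exists2 C : R, 0 <= C & forall n x, (0 < n)%N ->
  smooth_maximizer n x ->
  n.+1%:R * smooth_value n.+1 (y n.+1) <= n%:R * smooth_value n (y n) +
    payoff pi x (delta_mx 0 (l n.+1 w)) + C * (beta n / n.+1%:R) +
    n.+1%:R * value_jump n.
Proof.
have [lambda l0 sc] := good_perturbation_strong_concave hrho.
set A := payoff_bound pi; have A0 : 0 <= A by exact: payoff_bound_ge0.
pose C : R := m.+1%:R * (4 * A ^+ 2 / lambda).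
exists C.
  by rewrite mulr_ge0 ?ler0n // divr_ge0 ?(ltW l0) // mulr_ge0 // sqr_ge0.
move=> n x n0 xm; have [xi xmax] := xm.
have b0 := beta_gt0 n0; have bi0 : 0 < (beta n)^-1 by rewrite invr_gt0.
have nR : 0 < n.+1%:R :> R by rewrite ltr0n.
set s := (beta n)^-1 in bi0 *.
set V := smooth_value n (y n).
set px := payoff pi x (y n); set pd := payoff pi x (delta_mx 0 (l n.+1 w)).
(* Maximality of [x] is tested at the midpoint of [x] and [e], where strong concavity gains
   [s * lambda / 8] times the squared distance. *)
have quad e : simplex_int e ->
    payoff pi e (y n) + s * rho e <= px + s * rho x - s * lambda / 4 * enorm (e - x) ^+ 2.
  move=> ei.
  have h01 : 0 <= (2^-1 : R) <= 1 by lra.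
  have := xmax _ (simplex_int_segment xi ei h01).
  rewrite payoff_lin -/px -/s; have := sc x e _ xi ei h01.
  rewrite -(ler_pM2l bi0); set D := enorm _ ^+ 2; set r := rho (_ + _).
  lra.
have stepval : smooth_value n (y n.+1) <=
    V + (pd - px) / n.+1%:R + C * beta n / n.+1%:R ^+ 2.
  apply: smooth_value_le => // e ei.
  rewrite payoff_mean_actionS // -/(y n).
  have q := quad e ei.
  have Vx : px + s * (rho x - M0) <= V by exact: smooth_value_ge.
  set d := fun i => payoff pi (delta_mx 0 i) (delta_mx 0 (l n.+1 w)) -
    payoff pi (delta_mx 0 i) (y n).
  have dE : payoff pi e (delta_mx 0 (l n.+1 w)) - payoff pi e (y n) =
     pd - px + \sum_i (e 0 i - x 0 i) * d i.
    rewrite /pd /px !(payoffE pi e) !(payoffE pi x) -!sumrB -big_split /=.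
    by apply: eq_bigr => i _; rewrite /d; ring.
  have dA i : `|d i| <= 2 * A.
    apply: le_trans (ler_normB _ _) _.
    have yn : simplex (y n) by exact: mean_action_simplex.
    have := payoff_delta_bound pi i (delta_simplex (l n.+1 w)).
    have := payoff_delta_bound pi i yn.
    by rewrite -/A; lra.
  (* Coordinatewise, [u * v <= s * lambda / 4 * u ^+ 2 + v ^+ 2 / (s * lambda)] with
     [|v| <= 2 * A / n.+1]; the last terms add up to the constant [C]. *)
  have amgm : (\sum_i (e 0 i - x 0 i) * d i) / n.+1%:R <=
     s * lambda / 4 * enorm (e - x) ^+ 2 + C * beta n / n.+1%:R ^+ 2.
    rewrite enorm_sqr mulr_suml mulr_sumr.
    have -> : C * beta n / n.+1%:R ^+ 2 =
       \sum_(i < m.+1) (4 * A ^+ 2 / lambda * beta n / n.+1%:R ^+ 2).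
      by rewrite sumr_const card_ord -[RHS]mulr_natl /C !mulrA.
    rewrite -big_split /=; apply: ler_sum => i _; rewrite !mxE.
    set u := e 0 i + - x 0 i; set v := d i / n.+1%:R.
    have -> : (e 0 i - x 0 i) * d i / n.+1%:R = u * v by rewrite /v mulrA.
    have v2 : v ^+ 2 <= 4 * A ^+ 2 / n.+1%:R ^+ 2.
      rewrite /v expr_div_n ler_pM2r ?invr_gt0 ?exprn_gt0 //.
      rewrite -[d i ^+ 2]real_normK ?num_real //.
      have -> : 4 * A ^+ 2 = (2 * A) ^+ 2 by ring.
      by rewrite ler_pXn2r ?nnegrE ?mulr_ge0 ?normr_ge0.
    have c0 : 0 < s * lambda by rewrite mulr_gt0.
    have -> : 4 * A ^+ 2 / lambda * beta n / n.+1%:R ^+ 2 =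
      (4 * A ^+ 2 / n.+1%:R ^+ 2) / (s * lambda).
      by rewrite /s; field; rewrite !gt_eqF.
    apply: (@le_trans _ _ (s * lambda / 4 * u ^+ 2 + v ^+ 2 / (s * lambda))); last first.
      by rewrite lerD2l ler_pM2r ?invr_gt0.
    have : 0 <= (s * lambda / 2 * u - v) ^+ 2 / (s * lambda).
      by rewrite divr_ge0 ?sqr_ge0 // ltW.
    have -> : (s * lambda / 2 * u - v) ^+ 2 / (s * lambda) =
      s * lambda / 4 * u ^+ 2 + v ^+ 2 / (s * lambda) - u * v.
      by field; rewrite !gt_eqF.
    by rewrite subr_ge0.
  rewrite dE [(pd - px + _) / _]mulrDl /reg -/s.
  move: q Vx amgm; rewrite [s * (rho e - M0)]mulrBr [s * (rho x - M0)]mulrBr.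
  set D := (pd - px) / n.+1%:R; set S := (\sum_i _) / _.
  set Q := s * lambda / 4 * _; set B := C * beta n / _; set Pe := payoff pi e (y n).
  clearbody D S Q B Pe; lra.
(* One copy of [V] in [n.+1 * V] is absorbed by [px], which leaves [n * V + pd]. *)
have Vle : V <= px by exact: smooth_value_maximizer.
have -> : n.+1%:R * smooth_value n.+1 (y n.+1) =
   n.+1%:R * smooth_value n (y n.+1) + n.+1%:R * value_jump n.
  by rewrite /value_jump; ring.
rewrite lerD2r; move: stepval; rewrite -(ler_pM2l nR).
have -> : n.+1%:R * (V + (pd - px) / n.+1%:R + C * beta n / n.+1%:R ^+ 2) =
  n.+1%:R * V + (pd - px) + C * (beta n / n.+1%:R).
  by field; rewrite gt_eqF.
have -> : n.+1%:R * V = n%:R * V + V by rewrite -natr1 mulrDl mul1r.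
set X := C * _; set S := n.+1%:R * _; set nV := n%:R * V; clearbody X S nV; lra.
Qed.

Hypothesis beta_le : exists2 nu : R, nu < 1 &
  forall n, (1 <= n)%N -> beta n <= n%:R `^ nu.

Lemma beta_sublinear eps : 0 < eps -> exists n0, forall n, (n0 <= n)%N ->
  (0 < n)%N -> beta n <= eps * n%:R.
Proof.
move=> e0; have [nu nu1 H] := beta_le.
(* From [B] on, the ratio [n ^ (1 - nu)] of [n] to [n ^ nu] is at least [1 / eps]. *)
pose B : R := eps^-1 `^ (1 - nu)^-1.
exists (Num.truncn B).+1 => n Bn n0; apply: le_trans (H n n0) _.
have nR : 0 < n%:R :> R by rewrite ltr0n.
have nuE : n%:R = n%:R `^ nu * n%:R `^ (1 - nu) :> R.
  by rewrite -powRD ?subrKC ?powRr1 ?ler0n // gt_eqF // implybT.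
have B0 : 0 <= B by exact: powR_ge0.
have Bn' : B <= n%:R.
  have /andP[_ h] := truncn_itv B0.
  by apply: le_trans (ltW h) _; rewrite ler_nat.
have h : eps^-1 <= n%:R `^ (1 - nu).
  have -> : eps^-1 = B `^ (1 - nu).
    rewrite /B -powRrM mulVf ?powRr1 ?invr_ge0 ?(ltW e0) //.
    by rewrite gt_eqF // subr_gt0.
  by apply: ge0_ler_powR; rewrite ?nnegrE ?ler0n // ltW // subr_gt0.
rewrite {2}nuE mulrCA ler_peMr ?powR_ge0 //.
by rewrite -ler_pdivrMl // mulr1.
Qed.

Lemma beta_sum_sublinear eps : 0 < eps -> exists K : R, forall N,
  \sum_(1 <= n < N) beta n / n.+1%:R <= K + eps * N%:R.
Proof.
move=> e0; have [n0 H] := beta_sublinear e0.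
pose S N := \sum_(1 <= n < N) beta n / n.+1%:R.
have t0 n : (0 < n)%N -> 0 <= beta n / n.+1%:R.
  by move=> n1; rewrite divr_ge0 ?ler0n // ltW // beta_gt0.
have Spos N : 0 <= S N.
  by rewrite /S big_nat_cond sumr_ge0 // => n /andP[/andP[n1 _] _]; exact: t0.
exists (S n0.+1); elim=> [|N IH]; first by rewrite big_geq // mulr0 addr0 Spos.
have [Nn0|n0N] := leqP N.+1 n0.+1.
  apply: (@le_trans _ _ (S n0.+1)); last by rewrite lerDl mulr_ge0 ?ler0n // ltW.
  rewrite /S; case: N Nn0 {IH} => [|N] Nn0; first by rewrite big_geq // Spos.
  rewrite [leRHS](@big_cat_nat _ _ _ N.+2) //= lerDl big_nat_cond sumr_ge0 // => n.
  by rewrite andbT => /andP[n1 _]; apply: t0; exact: leq_trans n1.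
have N0 : (0 < N)%N by lia.
rewrite big_nat_recr //= -natr1 mulrDr mulr1 addrA lerD //.
rewrite natr1 ler_pdivrMr ?ltr0n //; apply: le_trans (H N _ N0) _; first by lia.
by rewrite ler_pM2l // ler_nat.
Qed.

Context (i : nat -> T -> 'I_m.+1) (x : nat -> 'rV[R]_m.+1).
Hypothesis xmax : forall n, (0 < n)%N -> smooth_maximizer n (x n).
Hypothesis noise : forall eps : R, 0 < eps -> exists N0, forall N, (N0 <= N)%N ->
  \sum_(1 <= n < N) (payoff pi (x n) (delta_mx 0 (l n.+1 w)) -
    pi (i n.+1 w) (l n.+1 w)) <= eps * N%:R.

(** Summing [smooth_value_step] from time 1 compares the smooth value with the payoffs of [x n].
    After division by [N], five errors of at most [eps / 8] remain: jumps, terms in [beta], noise,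
    distance to the best payoff, and the constants collected in [K]. *)
Lemma regret_eventually_le eps : 0 < eps -> exists N0, forall N, (N0 <= N)%N ->
  regret pi i l N w <= eps.
Proof.
move=> e0; have [C C0 step] := smooth_value_step.
have e8 : 0 < eps / 24 by rewrite divr_gt0.
have eC : 0 < eps / (8 * (C + 1)) by rewrite divr_gt0 // mulr_gt0 //; lra.
have [K1 HK1] := weighted_jump_small e8.
have [K2 HK2] := beta_sum_sublinear eC.
have e4 : 0 < eps / 8 by rewrite divr_gt0.
have [N1 HN1] := noise e4.
have [N2 N20 HN2] := smooth_value_near_best e4.
set V1 := smooth_value 1 (y 1).
have telescope N : N.+1%:R * smooth_value N.+1 (y N.+1) <= V1 +
    \sum_(1 <= n < N.+1) payoff pi (x n) (delta_mx 0 (l n.+1 w)) +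
    C * \sum_(1 <= n < N.+1) beta n / n.+1%:R +
    \sum_(1 <= n < N.+1) n.+1%:R * value_jump n.
  elim: N => [|N IH]; first by rewrite !big_geq // mulr0 !addr0 mul1r.
  rewrite !(@big_nat_recr _ _ _ N.+1 1 _ (ltn0Sn N)) /= mulrDr.
  move: IH (step N.+1 (x N.+1) (ltn0Sn N) (xmax (ltn0Sn N))).
  set a := N.+1%:R * smooth_value _ _; set a' := N.+2%:R * smooth_value _ _.
  set c := C * \sum_(_ <= _ < _) _; set c' := C * (beta N.+1 / _).
  set d := N.+2%:R * value_jump _; clearbody a a' c c' d; lra.
pose K := `|V1| + `|pi (i 1%N w) (l 1%N w)| + C * `|K2| + `|K1|.
pose N3 := (Num.truncn (K / (eps / 8))).+1.
exists (N1 + N2 + N3 + 1)%N => N NN.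
case: N NN => [|N] NN; first by lia.
have NR : 0 < N.+1%:R :> R by rewrite ltr0n.
have K0 : 0 <= K by rewrite !addr_ge0 ?mulr_ge0.
have KN : K <= eps / 8 * N.+1%:R.
  have q0 : 0 <= K / (eps / 8) by rewrite divr_ge0 // ltW.
  have /andP[_ h] := truncn_itv q0.
  rewrite mulrC -ler_pdivrMr //; apply: le_trans (ltW h) _.
  by rewrite ler_nat -/N3; move: NN; clear; lia.
have mp : N.+1%:R * mean_payoff pi i l N.+1 w = pi (i 1%N w) (l 1%N w) +
    \sum_(1 <= n < N.+1) pi (i n.+1 w) (l n.+1 w).
  rewrite /mean_payoff mulrA divff ?gt_eqF // mul1r big_nat_recl //.
rewrite -(ler_pM2l NR) /regret mulrBr mp.
have nearb : best_payoff pi (y N.+1) <= smooth_value N.+1 (y N.+1) + eps / 8.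
  rewrite -lerBlDr HN2 //; last exact: mean_action_simplex.
  by move: NN; clear; lia.
have nearb' : N.+1%:R * best_payoff pi (y N.+1) <=
   N.+1%:R * smooth_value N.+1 (y N.+1) + eps / 8 * N.+1%:R.
  by rewrite [eps / 8 * _]mulrC -mulrDr ler_pM2l.
have N1N : (N1 <= N.+1)%N by move: NN; clear; lia.
have nz := HN1 N.+1 N1N; rewrite sumrB in nz.
have h1 := HK1 N.+1; have h2 := HK2 N.+1.
have h3 : C * \sum_(1 <= n < N.+1) beta n / n.+1%:R <= C * `|K2| + eps / 8 * N.+1%:R.
  apply: (@le_trans _ _ (C * (K2 + eps / (8 * (C + 1)) * N.+1%:R))).
    by rewrite ler_wpM2l.
  rewrite mulrDr lerD //; first by rewrite ler_wpM2l // ler_norm.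
  rewrite mulrA ler_pM2r // mulrA ler_pdivrMr; last by lra.
  have -> : eps / 8 * (8 * (C + 1)) = C * eps + eps by field.
  by rewrite lerDl ltW.
have t := telescope N.
have a1 := ler_norm V1; have a2 := ler_norm (- pi (i 1%N w) (l 1%N w)).
have a3 := ler_norm K1; rewrite normrN in a2.
move: KN t nz h1 h3 nearb' a1 a2 a3; rewrite /K -/(y N.+1) [N.+1%:R * eps]mulrC.
set bst := N.+1%:R * best_payoff _ _; set sv := N.+1%:R * smooth_value _ _.
set sp := \sum_(1 <= n < N.+1) payoff _ _ _; set spi := \sum_(1 <= n < N.+1) pi _ _.
set sb := C * \sum_(_ <= _ < _) _; set sj := \sum_(_ <= _ < _) _.
set Ck := C * _; set n := N.+1%:R; set aV := `|V1|; set ap := `|pi _ _|; set aK := `|K1|.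
have -> : eps / 8 * n = (eps * n) / 8 by ring.
have -> : 3 * (eps / 24) * n = (eps * n) / 8 by field.
have : 0 < eps * n by rewrite mulr_gt0.
set en := eps * n; clearbody bst sv sp spi sb sj Ck aV ap aK en V1; lra.
Qed.

End DeterministicRegret.

(** * Conditional probabilities and the noise *)

Section ConditionalProbability.
Context {d : measure_display} {T : measurableType d} {R : realType}.
Context (P : probability T R) (G : set (set T)).
Hypothesis sG : sigma_algebra setT G.
Hypothesis Gm : G `<=` measurable.

Lemma sub_sigma_measurableE :
  (measurable : set (set (g_sigma_algebraType G))) = G.
Proof. exact: sigma_algebra_id. Qed.

Lemma sub_sigmaI A B : G A -> G B -> G (A `&` B).
Proof.
rewrite -sub_sigma_measurableE; exact: measurableI.
Qed.

Lemma sub_sigma_fin_bigcup (I : finType) (A : I -> set T) :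
  (forall a, G (A a)) -> G (\bigcup_a A a).
Proof.
rewrite -sub_sigma_measurableE => GA.
by apply: fin_bigcup_measurable => // a _; exact: GA.
Qed.

Lemma sub_sigma_fin_bigcap (I : finType) (A : I -> set T) :
  (forall a, G (A a)) -> G (\bigcap_a A a).
Proof.
rewrite -sub_sigma_measurableE => GA.
by apply: fin_bigcap_measurable => // a _; exact: GA.
Qed.

Lemma cond_prob_gt A q c : is_cond_prob P G A q -> G [set w | c < q w].
Proof.
move=> [mq _ _]; rewrite -sub_sigma_measurableE.
rewrite -[X in measurable X]setTI.
have -> : [set w | c < q w] = q @^-1` `]c, +oo[.
  by apply/seteqP; split => x /=; rewrite in_itv /= andbT.
exact: (mq measurableT _ (measurable_itv `]c, +oo[)).
Qed.

Lemma cond_prob_lt A q c : is_cond_prob P G A q -> G [set w | q w < c].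
Proof.
move=> [mq _ _]; rewrite -sub_sigma_measurableE.
rewrite -[X in measurable X]setTI.
have -> : [set w | q w < c] = q @^-1` `]-oo, c[.
  by apply/seteqP; split => x /=; rewrite in_itv.
exact: (mq measurableT _ (measurable_itv `]-oo, c[)).
Qed.

Lemma cond_prob_measurable A q : is_cond_prob P G A q -> measurable_fun setT q.
Proof. by move=> [_ /measurable_int/measurable_EFinP iq _]. Qed.

(** Local uniqueness of versions: on the parts of [B] where [p > c] or [p < c], both in [G], the
    difference [p - c] has constant sign and integral zero, so these parts are null. *)
Lemma cond_prob_ae_const A p q c B : is_cond_prob P G A p ->
  is_cond_prob P G A q -> G B -> (forall w, B w -> q w = c) ->
  ae_eq P B (EFin \o p) (cst c%:E).
Proof.
move=> hp hq GB qc.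
have [_ ip Hp] := hp; have [_ iq Hq] := hq.
have null B' : B' `<=` B -> G B' -> (forall w, B' w -> p w != c) ->
    (forall w, B' w -> `|(p w - c)%:E| = (p w - c)%:E)%E \/
    (forall w, B' w -> `|(p w - c)%:E| = (c - p w)%:E)%E ->
    P B' = 0%E.
  move=> B'B GB' pn sgn; have mB' := Gm GB'.
  have ipB : P.-integrable B' (EFin \o p) by exact: integrableS ip.
  have icB : P.-integrable B' (EFin \o cst c).
    apply: (@integrableS _ _ _ P setT) => //.
    exact: finite_measure_integrable_cst.
  have eqpc : (\int[P]_(w in B') (p w)%:E = \int[P]_(w in B') c%:E)%E.
    rewrite Hp // -Hq //; apply: eq_integral => w; rewrite inE => /B'B Bw.
    by rewrite qc.
  have fin : (\int[P]_(w in B') c%:E)%E \is a fin_num.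
    exact: (integrable_fin_num mB' icB).
  have z1 : (\int[P]_(w in B') (p w - c)%:E = 0)%E.
    have := integralB_EFin mB' ipB icB; rewrite /= eqpc subee //.
  have z2 : (\int[P]_(w in B') (c - p w)%:E = 0)%E.
    have := integralB_EFin mB' icB ipB; rewrite /= eqpc subee //.
  have mf : measurable_fun B' (fun w => (p w - c)%:E).
    apply/measurable_EFinP/measurable_funB => //.
    by apply: measurable_funTS; exact: cond_prob_measurable hp.
  have : (\int[P]_(w in B') `|(p w - c)%:E| = 0)%E.
    case: sgn => sgn; [rewrite -[RHS]z1|rewrite -[RHS]z2];
      by apply: eq_integral => w; rewrite inE => /sgn.
  move/(ae_eq_integral_abs P mB' mf) => [N [mN PN0 HN]].
  apply/eqP; rewrite -measure_le0 -PN0; apply: le_measure; rewrite ?inE //.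
  apply: subset_trans HN => w B'w /= /(_ B'w) [/eqP].
  by rewrite subr_eq0 (negbTE (pn w B'w)).
have Gp : G (B `&` [set w | c < p w]) by apply: sub_sigmaI => //; exact: cond_prob_gt hp.
have Gn : G (B `&` [set w | p w < c]) by apply: sub_sigmaI => //; exact: cond_prob_lt hp.
have Pp : P (B `&` [set w | c < p w]) = 0%E.
  apply: null => //.
  - by move=> w [_ /= h]; rewrite gt_eqF.
  - by left=> w [_ /= h]; rewrite /= ger0_norm // subr_ge0 ltW.
have Pn : P (B `&` [set w | p w < c]) = 0%E.
  apply: null => //.
  - by move=> w [_ /= h]; rewrite lt_eqF.
  - by right=> w [_ /= h]; rewrite /= ler0_norm ?opprB // subr_le0 ltW.
exists ((B `&` [set w | c < p w]) `|` (B `&` [set w | p w < c])); split.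
- by apply: measurableU; exact: Gm.
- by rewrite measureU0 //; exact: Gm.
- move=> w /= /not_implyP [Bw /= pn].
  by have [h|h|h] := ltgtP (p w) c; [right|left|case: pn; rewrite h].
Qed.

(** On [B] the factor [p] of the product version equals [c] almost everywhere and leaves the
    integral. This is how the independence of the moves enters. *)
Lemma cond_prob_indep_const A A' (A'' : set T) p q r c B : is_cond_prob P G A p ->
  is_cond_prob P G A' q -> is_cond_prob P G A'' (fun w => p w * q w) ->
  is_cond_prob P G A r -> G B -> (forall w, B w -> r w = c) ->
  P (A'' `&` B) = (c%:E * P (A' `&` B))%E.
Proof.
move=> hp hq hpq hr GB rc.
have ae := cond_prob_ae_const hp hr GB rc.
have mB := Gm GB; have [_ iq Hq] := hq; have [_ ipq Hpq] := hpq.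
rewrite -Hpq // -Hq // -integralZl //; last exact: integrableS iq.
apply: ae_eq_integral => //.
- apply/measurable_EFinP; apply: measurable_funTS.
  exact: cond_prob_measurable hpq.
- apply: measurable_funeM; apply/measurable_EFinP; apply: measurable_funTS.
  exact: cond_prob_measurable hq.
- by apply: filterS ae => w /= H /H [->]; rewrite EFinM.
Qed.

End ConditionalProbability.

(** * Finite-valued variables and second moments *)

Section FiniteValued.
Context {d : measure_display} {T : measurableType d} {R : realType}.
Context (P : probability T R).

Definition finite_valued {A : finType} (h : T -> A) :=
  forall a, measurable [set w | h w = a].

Definition law {A : finType} (h : T -> A) a : R := fine (P [set w | h w = a]).

Definition mean {A : finType} (h : T -> A) (f : A -> R) : R :=
  \sum_a f a * law h a.

Lemma law_ge0 (A : finType) (h : T -> A) a : 0 <= law h a.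
Proof. exact: fine_ge0. Qed.

Lemma finite_valued_seq (A : finType) (h : T -> A) (s : seq A) :
  finite_valued h -> uniq s -> measurable [set w | h w \in s] /\
  P [set w | h w \in s] = (\sum_(a <- s) law h a)%:E.
Proof.
move=> mh; elim: s => [_|a s IH /= /andP[as_ us]].
  have -> : [set w | h w \in [::]] = set0 by apply/seteqP; split.
  by rewrite measure0 big_nil; split => //; exact: measurable0.
have [ms Ps] := IH us.
have -> : [set w | h w \in a :: s] = [set w | h w = a] `|` [set w | h w \in s].
  apply/seteqP; split=> w /=; rewrite inE.
    by move=> /orP[/eqP|]; [left|right].
  by move=> [->|->]; rewrite ?eqxx ?orbT.
split; first by apply: measurableU; [exact: mh|exact: ms].
have -> : P ([set w | h w = a] `|` [set w | h w \in s]) =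
    (P [set w | h w = a] + P [set w | h w \in s])%E.
  apply: measureU; [exact: mh|exact: ms|].
  by apply/seteqP; split=> // w /= [-> has_]; rewrite has_ in as_.
by rewrite Ps big_cons EFinD /law fineK // fin_num_measure.
Qed.

Lemma law_event_measurable (A : finType) (h : T -> A) (Q : pred A) :
  finite_valued h -> measurable [set w | Q (h w)] /\
  fine (P [set w | Q (h w)]) = \sum_(a | Q a) law h a.
Proof.
move=> mh; have [mE PE] := finite_valued_seq mh (enum_uniq Q).
have setE : [set w | h w \in enum Q] = [set w | Q (h w)].
  by apply/seteqP; split=> w /=; rewrite mem_enum.
by rewrite setE in mE PE; rewrite PE big_enum.
Qed.

Lemma law_event (A : finType) (h : T -> A) (Q : pred A) : finite_valued h ->
  fine (P [set w | Q (h w)]) = \sum_(a | Q a) law h a.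
Proof. by move=> mh; have [] := law_event_measurable Q mh. Qed.

Lemma finite_valued_pair (A B : finType) (h : T -> A) (g : T -> B) :
  finite_valued h -> finite_valued g -> finite_valued (fun w => (h w, g w)).
Proof.
move=> mh mg [a b]; have -> : [set w | (h w, g w) = (a, b)] =
    [set w | h w = a] `&` [set w | g w = b].
  by apply/seteqP; split=> w /= [-> ->].
exact: measurableI.
Qed.

Lemma sum_law (A : finType) (h : T -> A) : finite_valued h -> \sum_a law h a = 1.
Proof.
move=> mh; rewrite -(law_event predT mh).
have -> : [set w | predT (h w)] = setT by apply/seteqP; split.
by rewrite probability_setT.
Qed.

Lemma mean_comp (A B : finType) (h : T -> A) (h' : T -> B) (g : B -> A) f :
  finite_valued h' -> (forall w, h w = g (h' w)) ->
  mean h f = mean h' (f \o g).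
Proof.
move=> mh' hg; rewrite /mean (partition_big g predT) //=; apply: eq_bigr => a _.
have -> : law h a = \sum_(b | g b == a) law h' b.
  rewrite -(law_event (fun b => g b == a) mh') /law; congr (fine (P _)).
  by apply/seteqP; split=> w /=; rewrite hg => /eqP.
by rewrite mulr_sumr; apply: eq_bigr => b /eqP ->.
Qed.

(** Both sides are sums over the joint law; pairs that are never attained, where [f] and [f'] may
    differ, have probability zero. *)
Lemma eq_mean (A B : finType) (h : T -> A) (h' : T -> B) f f' :
  finite_valued h -> finite_valued h' -> (forall w, f (h w) = f' (h' w)) ->
  mean h f = mean h' f'.
Proof.
move=> mh mh' ff.
have mp := finite_valued_pair mh mh'.
rewrite (mean_comp (g := fst) f mp) // (mean_comp (g := snd) f' mp) //.
apply: eq_bigr => -[a b] _ /=; have [->|] := eqVneq (law (fun w => (h w, h' w)) (a, b)) 0.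
  by rewrite !mulr0.
have [[w /= [<- <-]]|ne] := pselect (exists w, (h w, h' w) = (a, b)).
  by rewrite ff.
rewrite /law (_ : [set w | _] = set0) ?measure0 ?eqxx //.
by apply/seteqP; split=> // w /= hw; apply: ne; exists w.
Qed.

Lemma chebyshev_finite (A : finType) (h : T -> A) (f : A -> R) c :
  finite_valued h -> 0 < c ->
  (P [set w | (c <= `|f (h w)|)%R] <= (mean h (fun a => f a ^+ 2) / c ^+ 2)%:E)%E.
Proof.
move=> mh c0; have mE : measurable [set w | (c <= `|f (h w)|)%R].
  by have [] := law_event_measurable (fun a => c <= `|f a|) mh.
rewrite -[leLHS]fineK ?fin_num_measure // lee_fin.
rewrite (law_event (fun a => c <= `|f a|) mh).
rewrite ler_pdivlMr ?exprn_gt0 // mulr_suml big_mkcond /=.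
apply: ler_sum => a _; case: ifP => [h1|_]; last first.
  by rewrite mulr_ge0 ?sqr_ge0 ?law_ge0.
rewrite mulrC ler_wpM2r ?law_ge0 //.
rewrite -[f a ^+ 2]real_normK ?num_real //.
by rewrite ler_pXn2r ?nnegrE ?normr_ge0 // ltW.
Qed.

Lemma factor_through (A : Type) (h : T -> A) (B : pointedType) (Z : T -> B) :
  (forall w w', h w = h w' -> Z w = Z w') -> exists f, forall w, Z w = f (h w).
Proof.
move=> Zh.
have [f Hf] : {f : A -> B & forall a, forall w, h w = a -> Z w = f a}.
  apply: (@choice _ _ (fun a b => forall w, h w = a -> Z w = b)) => a.
  have [[w hw]|ne] := pselect (exists w, h w = a).
    by exists (Z w) => w' hw'; apply: Zh; rewrite hw hw'.
  by exists point => w hw; case: ne; exists w.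
by exists f => w; exact: Hf.
Qed.

Context {m k : nat} (pi : 'I_m.+1 -> 'I_k.+1 -> R).

(** The cross term of the square vanishes: given [h = g] and nature's move [b], player 1 draws [a]
    with weight [x g 0 a] by independence, so the difference of payoffs has mean zero. *)
Lemma second_moment_step (G : set (set T)) (A : finType) (h : T -> A)
    (s : A -> R) (x : A -> 'rV[R]_m.+1) (i : T -> 'I_m.+1) (l : T -> 'I_k.+1) :
  sigma_algebra setT G -> G `<=` measurable ->
  (forall a, G [set w | h w = a]) ->
  finite_valued i -> finite_valued l ->
  (forall g a, 0 <= x g 0 a <= 1) ->
  (forall a, is_cond_prob P G [set w | i w = a] (fun w => x (h w) 0 a)) ->
  (forall a b, exists p q : T -> R,
    [/\ is_cond_prob P G [set w | i w = a] p,
        is_cond_prob P G [set w | l w = b] q &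
        is_cond_prob P G [set w | i w = a /\ l w = b] (fun w => p w * q w)]) ->
  mean (fun w => (h w, (i w, l w)))
    (fun u => (s u.1 + (payoff pi (x u.1) (delta_mx 0 u.2.2) - pi u.2.1 u.2.2)) ^+ 2) <=
  mean h (fun g => s g ^+ 2) + (2 * payoff_bound pi) ^+ 2.
Proof.
move=> sG Gm Gh mi ml x01 ci ind.
have mh : finite_valued h by move=> a; exact: Gm.
set h' := fun w => _; have mh' : finite_valued h'.
  by apply: finite_valued_pair => //; exact: finite_valued_pair.
set D := fun u : A * ('I_m.+1 * 'I_k.+1) =>
  payoff pi (x u.1) (delta_mx 0 u.2.2) - pi u.2.1 u.2.2.
have -> : mean h' (fun u => (s u.1 + D u) ^+ 2) =
    mean h (fun g => s g ^+ 2) + 2 * (\sum_u s u.1 * D u * law h' u) +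
    mean h' (fun u => D u ^+ 2).
  rewrite (mean_comp (g := fst) _ mh') // /mean mulr_sumr -!big_split /=.
  by apply: eq_bigr => u _; ring.
have -> : \sum_u s u.1 * D u * law h' u = 0.
  transitivity (\sum_g \sum_ab s g * D (g, ab) * law h' (g, ab)).
    by rewrite pair_bigA; apply: eq_bigr => -[].
  apply: big1 => g _.
  pose Pg b := fine (P ([set w | l w = b] `&` [set w | h w = g])).
  have lawE a b : law h' (g, (a, b)) = x g 0 a * Pg b.
    rewrite /law /Pg.
    have -> : [set w | h' w = (g, (a, b))] =
       [set w | i w = a /\ l w = b] `&` [set w | h w = g].
      by apply/seteqP; split=> w /=; rewrite /h' => -[]; [move=> -> -> ->|move=> [-> ->] ->].
    have [p [q [hp hq hpq]]] := ind a b.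
    rewrite (cond_prob_indep_const sG Gm hp hq hpq (ci a) (Gh g) (c := x g 0 a)).
      by rewrite fineM // fin_num_measure //; apply: measurableI; [exact: ml|exact: mh].
    by move=> w /= ->.
  (* The marginal is obtained by summing the joint law: [x g] is only assumed to have coordinates in
     [0, 1], since [smooth_br] may return a default vector. *)
  have PgE b : Pg b = \sum_a law h' (g, (a, b)).
    transitivity (\sum_(u : A * ('I_m.+1 * 'I_k.+1) | (u.1 == g) && (u.2.2 == b))
        law h' u).
      rewrite -(law_event (fun u : A * ('I_m.+1 * 'I_k.+1) =>
        (u.1 == g) && (u.2.2 == b)) mh').
      congr (fine (P _)); apply/seteqP; split=> w /=; rewrite /h' /=.
        by move=> [-> ->]; rewrite !eqxx.
      by move=> /andP[/eqP -> /eqP ->].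
    transitivity (\sum_(g' | g' == g) \sum_(ab : 'I_m.+1 * 'I_k.+1 | ab.2 == b)
      law h' (g', ab)).
      by rewrite pair_big_dep; apply: eq_bigr => -[].
    rewrite big_pred1_eq.
    transitivity (\sum_a \sum_(b' | b' == b) law h' (g, (a, b'))).
      by rewrite pair_big_dep; apply: eq_bigr => -[].
    by apply: eq_bigr => a _; rewrite big_pred1_eq.
  transitivity (s g * \sum_ab D (g, ab) * law h' (g, ab)).
    by rewrite mulr_sumr; apply: eq_bigr => ab _; rewrite mulrA.
  rewrite (_ : \sum_ab _ = 0) ?mulr0 //.
  transitivity (\sum_a \sum_b D (g, (a, b)) * law h' (g, (a, b))).
    by rewrite pair_bigA; apply: eq_bigr => -[].
  rewrite exchange_big /= big1 // => b _.
  rewrite /D /= (eq_bigr (fun a => payoff pi (x g) (delta_mx 0 b) * law h' (g, (a, b)) -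
    pi a b * x g 0 a * Pg b)); last first.
    by move=> a _; rewrite lawE; ring.
  rewrite sumrB -mulr_sumr -PgE payoff_delta -mulr_suml.
  by rewrite subrr.
rewrite mulr0 addr0 lerD2l.
rewrite -[leRHS]mulr1 -[X in _ <= _ * X](sum_law mh') mulr_sumr; apply: ler_sum => u _.
rewrite ler_wpM2r ?law_ge0 // -[D u ^+ 2]real_normK ?num_real //.
have b0 := payoff_bound_ge0 pi.
rewrite ler_pXn2r ?nnegrE ?normr_ge0 // ?mulr_ge0 //.
apply: le_trans (ler_normB _ _) _; rewrite mulr_natl mulr2n.
apply: lerD; last exact: pi_bound.
rewrite payoff_delta; apply: le_trans (ler_norm_sum _ _ _) _.
rewrite /payoff_bound; apply: ler_sum => a _.
rewrite (bigD1 u.2.2) //= -[leLHS]addr0 lerD ?sumr_ge0 //.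
have /andP[x0 x1] := x01 u.1 a.
by rewrite normrM (ger0_norm x0) ler_piMr.
Qed.

End FiniteValued.

(** * From squares to all integers *)

Section Interpolation.
Context {R : realType}.

Lemma sqrt_bracket N : (0 < N)%N ->
  exists j, (j.+1 ^ 2 <= N)%N /\ (N < j.+2 ^ 2)%N.
Proof.
elim: N => // N IH _; have [->|N0] := posnP N; first by exists 0%N.
have [j [h1 h2]] := IH N0.
have [h|h] := leqP j.+2 N.+1; last by exists j; split; lia.
by have [h'|h'] := leqP (j.+2 ^ 2) N.+1; [exists j.+1|exists j]; split=> //; nia.
Qed.

(** Since the last square the sequence grows by at most [B] per step during [O(sqrt N)] steps, which
    is negligible with respect to [N]. *)
Lemma sublinear_of_squares (M : nat -> R) (B : R) :
  (forall N, (0 < N)%N -> M N.+1 - M N <= B) ->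
  (forall r : nat, exists j0, forall j, (j0 <= j)%N ->
    M (j.+1 ^ 2)%N < r.+1%:R^-1 * (j.+1 ^ 2)%:R) ->
  forall eps, 0 < eps -> exists N0, forall N, (N0 <= N)%N -> M N <= eps * N%:R.
Proof.
move=> MB Msq eps e0.
pose B' := `|B|; have B'0 : 0 <= B' by exact: normr_ge0.
have incr N p : (0 < N)%N -> M (N + p)%N <= M N + p%:R * B'.
  move=> N0; elim: p => [|p IHp]; first by rewrite addn0 mul0r addr0.
  have := MB (N + p)%N; rewrite addn_gt0 N0 => /(_ isT).
  have := ler_norm B; rewrite -/B' addnS -natr1 mulrDl mul1r; lra.
have e2 : 0 <= 2 / eps by rewrite divr_ge0 // ltW.
have [j0 Hj0] := Msq (Num.truncn (2 / eps)).
have r_eps : (Num.truncn (2 / eps)).+1%:R^-1 <= eps / 2.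
  have /andP[_ h] := truncn_itv e2.
  rewrite -[eps / 2]invrK lef_pV2 ?posrE ?invr_gt0 ?divr_gt0 ?ltr0n //.
  by rewrite invf_div ltW.
pose j1 := Num.truncn (6 * B' / eps).
have q0 : 0 <= 6 * B' / eps by rewrite divr_ge0 ?mulr_ge0 // ltW.
exists ((j0 + j1).+2 ^ 2)%N => N HN.
have N0 : (0 < N)%N by apply: leq_trans HN; rewrite expn_gt0.
have [j [h1 h2]] := sqrt_bracket N0.
have jj : (j0 + j1 < j.+1)%N.
  by rewrite -(ltn_sqr) -[(_ < _)%N]ltnS; nia.
have jR : 6 * B' <= eps * j.+1%:R.
  have /andP[_ h] := truncn_itv q0.
  rewrite -ler_pdivrMl // mulrC; apply: le_trans (ltW h) _.
  by rewrite ler_nat -/j1; move: jj; clear; lia.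
have sq := Hj0 j (_ : (j0 <= j)%N).
have {}sq : M (j.+1 ^ 2)%N < (Num.truncn (2 / eps)).+1%:R^-1 * (j.+1 ^ 2)%:R.
  by apply: sq; lia.
have := incr (j.+1 ^ 2)%N (N - j.+1 ^ 2)%N; rewrite expn_gt0 /= => /(_ isT).
rewrite subnKC // => hM.
have gap : (N - j.+1 ^ 2)%:R <= 3 * j.+1%:R :> R.
  by rewrite -natrM ler_nat; nia.
have sqN : (j.+1 ^ 2)%:R <= N%:R :> R by rewrite ler_nat.
have jsq : j.+1%:R * j.+1%:R = (j.+1 ^ 2)%:R :> R by rewrite -natrM mulnn.
have g1 : (N - j.+1 ^ 2)%:R * B' <= 3 * j.+1%:R * B' by rewrite ler_wpM2r.
have g2 : 6 * B' * j.+1%:R <= eps * (j.+1 ^ 2)%:R.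
  by rewrite -jsq mulrA ler_wpM2r ?ler0n.
have g3 : (Num.truncn (2 / eps)).+1%:R^-1 * (j.+1 ^ 2)%:R <= eps / 2 * (j.+1 ^ 2)%:R.
  by rewrite ler_wpM2r ?ler0n.
have g4 : eps * (j.+1 ^ 2)%:R <= eps * N%:R by rewrite ler_pM2l.
move: hM sq g1 g2 g3 g4; set a := M _; set b := M _; set c := _^-1 * _.
set X := (N - _)%:R * B'; set J := j.+1%:R; set S := (j.+1 ^ 2)%:R.
clearbody a b c X J S; lra.
Qed.

(** The induction needs the sharper bound [2 - 1 / N.+1] for [N.+1] terms. *)
Lemma sum_inv_sqr N : \sum_(0 <= n < N) (n.+1%:R ^+ 2)^-1 <= 2 :> R.
Proof.
suff : \sum_(0 <= n < N.+1) (n.+1%:R ^+ 2)^-1 <= 2 - N.+1%:R^-1 :> R.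
  move=> h; apply: (@le_trans _ _ (\sum_(0 <= n < N.+1) (n.+1%:R ^+ 2)^-1 : R)).
    by rewrite big_nat_recr //= lerDl invr_ge0 sqr_ge0.
  by apply: le_trans h _; rewrite lerBlDr lerDl invr_ge0 ler0n.
elim: N => [|N IH]; first by rewrite big_nat1 expr1n invr1; lra.
rewrite big_nat_recr //=; apply: le_trans (lerD IH (lexx _)) _.
have N1 : 0 < N.+1%:R :> R by rewrite ltr0n.
have N2 : 0 < N.+2%:R :> R by rewrite ltr0n.
rewrite -subr_ge0.
have -> : 2 - N.+2%:R^-1 - (2 - N.+1%:R^-1 + (N.+2%:R ^+ 2)^-1) =
   (N.+1%:R * N.+2%:R ^+ 2)^-1 :> R.
  rewrite -[N.+2%:R]natr1 -[N.+1%:R]natr1; have n0 : 0 <= N%:R :> R by exact: ler0n.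
  by set n := N%:R in n0 *; field; rewrite ?gt_eqF //=; lra.
by rewrite invr_ge0 mulr_ge0 ?sqr_ge0 // ltW.
Qed.

End Interpolation.

(** * The noise along the play *)

Section PlayNoise.
Context {R : realType} {m k : nat} (pi : 'I_m.+1 -> 'I_k.+1 -> R).
Context (rho : 'rV[R]_m.+1 -> R) (beta : nat -> R).
Context {d : measure_display} {T : measurableType d} (P : probability T R).
Context (F : nat -> set (set T)) (i : nat -> T -> 'I_m.+1) (l : nat -> T -> 'I_k.+1).
Hypothesis hF : filtration F.
Hypothesis hi : adapted F i.
Hypothesis hl : adapted F l.
Hypothesis hind : independent_play P F i l.
Hypothesis hvsfp : VSFP P pi rho beta F i l.

Let Fs n : sigma_algebra setT (F n). Proof. by case: hF. Qed.
Let Fm n : F n `<=` measurable. Proof. by case: hF => _ + _; exact. Qed.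

Lemma filtration_le n p : (n <= p)%N -> F n `<=` F p.
Proof.
elim: p => [|p IH]; first by rewrite leqn0 => /eqP ->.
rewrite leq_eqVlt => /orP[/eqP -> //|]; rewrite ltnS => np.
by apply: subset_trans (IH np) _; case: hF.
Qed.

(** The moves at times 1 to [n], as an element of a finite type, so that moments are finite sums. *)
Definition history n w : {ffun 'I_n -> 'I_m.+1 * 'I_k.+1} :=
  [ffun j : 'I_n => (i j.+1 w, l j.+1 w)].

Lemma history_fiber n a : F n [set w | history n w = a].
Proof.
have -> : [set w | history n w = a] =
    \bigcap_(j in setT) ([set w | i (j : 'I_n).+1 w = (a j).1] `&`
                         [set w | l j.+1 w = (a j).2]).
  apply/seteqP; split=> w /=.
    by move=> <- j _; rewrite ffunE.
  by move=> H; apply/ffunP => j; rewrite ffunE; have [/= -> ->] := H j Logic.I; case: (a j).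
apply: (sub_sigma_fin_bigcap (Fs n)) => j; apply: (sub_sigmaI (Fs n)).
  by apply: (filtration_le (ltn_ord j)); exact: hi.
by apply: (filtration_le (ltn_ord j)); exact: hl.
Qed.

Lemma history_finite n : finite_valued (history n).
Proof. by move=> a; apply: Fm; exact: history_fiber. Qed.

Lemma i_finite n : (0 < n)%N -> finite_valued (i n).
Proof. by move=> n0 a; apply: (@Fm n); exact: hi. Qed.

Lemma l_finite n : (0 < n)%N -> finite_valued (l n).
Proof. by move=> n0 a; apply: (@Fm n); exact: hl. Qed.

Lemma history_eq n w w' j : history n w = history n w' -> (0 < j <= n)%N ->
  i j w = i j w' /\ l j w = l j w'.
Proof.
move=> hw /andP[j0 jn]; have jn' : (j.-1 < n)%N by rewrite prednK.
by have /ffunP/(_ (Ordinal jn')) := hw; rewrite !ffunE /= prednK // => -[-> ->].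
Qed.

Lemma mean_action_history n w w' : history n w = history n w' ->
  mean_action l n w = mean_action l n w' :> 'rV[R]_k.+1.
Proof.
move=> hw; rewrite /mean_action; congr (_ *: _); apply: eq_big_nat => j jn.
by have [_ ->] := history_eq hw jn.
Qed.

Definition br n w : 'rV[R]_m.+1 := smooth_br pi rho (mean_action l n w) (beta n).

Lemma smooth_br_coord01 y c a : 0 <= (smooth_br pi rho y c) 0 a <= 1.
Proof.
rewrite /smooth_br; set S := [set x | _].
have [[x Sx]|nS] := pselect (exists x, S x).
  have [[s _] _] := getPex (ex_intro _ x Sx).
  by rewrite simplex_le1 // andbT; case: s.
rewrite getPN => [|x Sx]; last by apply: nS; exists x.
by rewrite mxE lexx ler01.
Qed.

Definition noise n w := payoff pi (br n w) (delta_mx 0 (l n.+1 w)) -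
  pi (i n.+1 w) (l n.+1 w).

Definition noise_sum N w := \sum_(1 <= n < N) noise n w.

Lemma noise_le n w : noise n w <= 2 * payoff_bound pi.
Proof.
apply: le_trans (ler_norm _) _; apply: le_trans (ler_normB _ _) _.
rewrite mulr_natl mulr2n; apply: lerD; last exact: pi_bound.
rewrite payoff_delta; apply: le_trans (ler_norm_sum _ _ _) _.
rewrite /payoff_bound; apply: ler_sum => a _.
rewrite (bigD1 (l n.+1 w)) //= -[leLHS]addr0 lerD ?sumr_ge0 //.
have /andP[x0 x1] := smooth_br_coord01 (mean_action l n w) (beta n) a.
by rewrite normrM (ger0_norm x0) ler_piMr.
Qed.

(** The noise terms are orthogonal, so each step adds at most [(2 * payoff_bound pi) ^+ 2]. The last
    term of the sum involves the moves at time [N], hence a function of the history up to [N]. *)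
Lemma noise_sum_second_moment N : (0 < N)%N -> exists2 f : {ffun 'I_N -> 'I_m.+1 * 'I_k.+1} -> R,
  (forall w, noise_sum N w = f (history N w)) &
  mean P (history N) (fun a => f a ^+ 2) <= (2 * payoff_bound pi) ^+ 2 * N%:R.
Proof.
elim: N => // N IH _; have [->|N0] := posnP N.
  exists (fun=> 0) => [w|]; first by rewrite /noise_sum big_geq.
  rewrite /mean big1 => [|a _]; last by rewrite expr0n mul0r.
  by rewrite mulr1 sqr_ge0.
have [f ff mf] := IH N0.
have [ya Hya] := factor_through (@mean_action_history N).
pose x a : 'rV[R]_m.+1 := smooth_br pi rho (ya a) (beta N).
have brE w : br N w = x (history N w) by rewrite /br Hya.
have det w w' : history N.+1 w = history N.+1 w' -> noise_sum N.+1 w = noise_sum N.+1 w'.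
  move=> hw; rewrite /noise_sum; apply: eq_big_nat => n /andP[n1 nN].
  have n1N : (0 < n.+1 <= N.+1)%N by rewrite ltnW.
  rewrite /noise; have [-> ->] := history_eq hw n1N.
  congr (payoff _ _ _ - _); rewrite /br; congr smooth_br.
  rewrite /mean_action; congr (_ *: _); apply: eq_big_nat => j /andP[j1 jn].
  have j1N : (0 < j <= N.+1)%N by move: j1 jn nN; clear; lia.
  by have [_ ->] := history_eq hw j1N.
have [f' Hf'] := factor_through det.
exists f' => //.
have step := @second_moment_step d T R P m k pi (F N) _ (history N) f x (i N.+1) (l N.+1)
  (Fs N) (@Fm N) (@history_fiber N) (i_finite (ltn0Sn N)) (l_finite (ltn0Sn N))
  (fun g a => smooth_br_coord01 _ _ _).
have {}step := step _ (hind N).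
rewrite -[N.+1%:R]natr1 mulrDr mulr1; apply: le_trans (lerD mf (lexx _)).
apply: le_trans (step _); last first.
  move=> a; have := hvsfp a N0; congr (is_cond_prob _ _ _ _).
  by apply/funext => w; rewrite -brE.
rewrite le_eqVlt; apply/orP; left; apply/eqP.
apply: eq_mean.
- exact: history_finite.
- apply: finite_valued_pair; first exact: history_finite.
  by apply: finite_valued_pair; [exact: i_finite|exact: l_finite].
- by move=> w /=; rewrite -Hf' -ff -brE /noise_sum big_nat_recr.
Qed.

(** At [N = j.+1 ^ 2], Chebyshev bounds the probability of a deviation [eps * N] by [C / N], which
    is summable over [j]; then Borel-Cantelli. *)
Lemma noise_sum_squares_ae (eps : R) : 0 < eps -> {ae P, forall w, exists j0,
  forall j, (j0 <= j)%N -> noise_sum (j.+1 ^ 2) w < eps * (j.+1 ^ 2)%:R}.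
Proof.
move=> e0; pose E j := [set w | (eps * (j.+1 ^ 2)%:R <= `|noise_sum (j.+1 ^ 2) w|)%R].
have sq0 j : (0 < j.+1 ^ 2)%N by rewrite expn_gt0.
have mE j : measurable (E j).
  have [f Hf _] := noise_sum_second_moment (sq0 j).
  have -> : E j = [set w | (fun a => eps * (j.+1 ^ 2)%:R <= `|f a|) (history (j.+1 ^ 2) w)].
    by apply/seteqP; split=> w; rewrite /E /= Hf.
  by have [] := law_event_measurable P (fun a => eps * (j.+1 ^ 2)%:R <= `|f a|)
    (@history_finite (j.+1 ^ 2)%N).
pose C : R := (2 * payoff_bound pi) ^+ 2 / eps ^+ 2.
have C0 : 0 <= C by rewrite divr_ge0 ?sqr_ge0.
have PE j : (P (E j) <= (C * (j.+1%:R ^+ 2)^-1)%:E)%E.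
  have [f Hf mf] := noise_sum_second_moment (sq0 j).
  have -> : E j = [set w | (eps * (j.+1 ^ 2)%:R <= `|f (history (j.+1 ^ 2) w)|)%R].
    by apply/seteqP; split=> w; rewrite /E /= Hf.
  have sqR : 0 < (j.+1 ^ 2)%:R :> R by rewrite ltr0n.
  apply: le_trans (chebyshev_finite _ _ (@history_finite _) _) _; first exact: mulr_gt0.
  rewrite lee_fin ler_pdivrMr ?exprn_gt0 ?mulr_gt0 //; apply: le_trans mf _.
  rewrite /C natrX le_eqVlt; apply/orP; left; apply/eqP.
  have jR : 0 < j.+1%:R :> R by rewrite ltr0n.
  by move: jR; set J := j.+1%:R => jR; field; rewrite !gt_eqF.
have finsum : (\sum_(n <oo) P (E n) < +oo)%E.
  apply: (@le_lt_trans _ _ (C * 2)%:E); last exact: ltry.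
  apply: lime_le; first by apply: is_cvg_nneseries => n _ _; exact: measure_ge0.
  apply: nearW => N; apply: (@le_trans _ _ (\sum_(0 <= n < N) (C * (n.+1%:R ^+ 2)^-1)%:E)%E).
    by apply: lee_sum => n _; exact: PE.
  by rewrite sumEFin lee_fin -mulr_sumr ler_wpM2l // sum_inv_sqr.
have BC := lim_sup_set_cvg0 mE finsum.
exists (lim_sup_set E); split=> //.
  by apply: bigcapT_measurable => n; apply: bigcup_measurable => p _; exact: mE.
move=> w /= nex n _; apply: contrapT => nin; apply: nex; exists n => j nj.
rewrite ltNge; apply/negP => h; apply: nin; exists j => //.
by rewrite /E /=; apply: le_trans h (ler_norm _).
Qed.

Lemma noise_sublinear_ae : {ae P, forall w, forall eps : R, 0 < eps ->
  exists N0, forall N, (N0 <= N)%N -> noise_sum N w <= eps * N%:R}.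
Proof.
have H : {ae P, forall w, forall r : nat, exists j0, forall j, (j0 <= j)%N ->
    noise_sum (j.+1 ^ 2) w < r.+1%:R^-1 * (j.+1 ^ 2)%:R}.
  by apply: ae_foralln => r; apply: noise_sum_squares_ae; rewrite invr_gt0 ltr0n.
apply: filterS H => w Hw.
apply: (sublinear_of_squares (B := 2 * payoff_bound pi)) Hw => N N0.
by rewrite /noise_sum big_nat_recr //= addrAC subrr add0r noise_le.
Qed.

(* When no maximizer exists, [get] returns the zero vector, whose coordinates
   do not sum to 1, so this event is null for any version of the conditional
   law of the next move. *)
Lemma br_maximizer_ae : {ae P, forall w, forall n, (0 < n)%N ->
  smooth_maximizer pi rho beta l w n (br n w)}.
Proof.
apply: ae_foralln => n; have [->|n0] := posnP n; first exact: aeW.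
pose Q (y : 'rV[R]_k.+1) := exists x, simplex_int x /\ forall z, simplex_int z ->
    payoff pi z y + (beta n)^-1 * rho z <= payoff pi x y + (beta n)^-1 * rho x.
pose bad w := `[< ~ Q (mean_action l n w) >].
have det w w' : history n w = history n w' -> bad w = bad w'.
  by move=> hw; rewrite /bad (mean_action_history hw).
have [f Hf] := factor_through det.
have Fbad : F n [set w | bad w].
  have -> : [set w | bad w] = \bigcup_(a in setT)
      [set w | (history n w = a) /\ f a].
    apply/seteqP; split=> w /=; first by rewrite Hf => h; exists (history n w).
    by move=> [a _ /= [<-]]; rewrite Hf.
  apply: (sub_sigma_fin_bigcup (Fs n)) => a; case: (boolP (f a)) => fa.
    have -> : [set w | history n w = a /\ true] = [set w | history n w = a].
      by apply/seteqP; split=> w //= [].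
    exact: history_fiber.
  have -> : [set w | history n w = a /\ false] = set0.
    by apply/seteqP; split=> w //= [].
  by have [] := Fs n.
have mbad := Fm Fbad.
have mb : finite_valued bad.
  case; first exact: mbad.
  have -> : [set w | bad w = false] = ~` [set w | bad w].
    by apply/seteqP; split=> w /=; case: (bad w).
  exact: measurableC.
have br0 w : bad w -> br n w = 0.
  move=> /asboolP nQ; rewrite /br /smooth_br getPN => [|x Sx]; last by apply: nQ; exists x.
  by apply/rowP => a; rewrite !mxE.
have mh := finite_valued_pair (i_finite (ltn0Sn n)) mb.
(* Split according to the next move [a]: the version given by [hvsfp] vanishes on the event for
   every [a], while some move must occur. *)
have Pbad : P [set w | bad w] = 0%E.
  rewrite -[LHS]fineK ?fin_num_measure // (law_event P (fun u => u.2) mh) big1 // => -[a c] /= ->.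
  rewrite /law.
  have -> : [set w | (i n.+1 w, bad w) = (a, true)] =
      [set w | i n.+1 w = a] `&` [set w | bad w].
    by apply/seteqP; split=> w /= [-> ->].
  have [_ _ H] := hvsfp a n0.
  rewrite -H // (eq_integral (cst 0%E)) ?integral0 // => w; rewrite inE => /= bw.
  by rewrite -/(br n w) br0 // mxE.
exists [set w | bad w]; split=> // w /= nmax.
apply/asboolP => -[x Sx]; apply: nmax => _.
rewrite /smooth_maximizer /br /smooth_br; set S := [set z | _].
by have : S (get S) by apply: getPex; exists x.
Qed.

End PlayNoise.

(** * Consistency of the strategy *)

Lemma limn_esup_le0 (R : realType) (u : nat -> R) :
  (forall eps : R, 0 < eps -> exists N0, forall N, (N0 <= N)%N -> u N <= eps) ->
  (limn_esup (fun n => (u n)%:E) <= 0)%E.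
Proof.
move=> H; apply/lee_addgt0Pr => eps e0; rewrite add0e.
have [N0 HN] := H eps e0.
apply: ge_ereal_inf; exists (ereal_sup [set (u n)%:E | n in [set n | (N0 <= n)%N]]).
  by exists [set n | (N0 <= n)%N] => //; exists N0.
by apply: ge_ereal_sup => _ [n /= nN0 <-]; rewrite lee_fin HN.
Qed.

Theorem theorem1p8 (R : realType) (m k : nat)
    (pi : 'I_m.+1 -> 'I_k.+1 -> R)
    (rho : 'rV[R]_m.+1 -> R) (hrho : good_perturbation rho)
    (beta : nat -> R)
    (beta_gt0 : forall n, (1 <= n)%N -> 0 < beta n)
    (beta_nd : forall n p, (1 <= n)%N -> (n <= p)%N -> beta n <= beta p)
    (beta_oo : beta n @[n --> \oo] --> +oo)
    (beta_le : exists2 nu : R, nu < 1 &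
       forall n, (1 <= n)%N -> beta n <= n%:R `^ nu)
    (d : measure_display) (T : measurableType d) (P : probability T R)
    (F : nat -> set (set T)) (hF : filtration F)
    (i : nat -> T -> 'I_m.+1) (l : nat -> T -> 'I_k.+1)
    (hi : adapted F i) (hl : adapted F l)
    (hind : independent_play P F i l)
    (hvsfp : VSFP P pi rho beta F i l) :
  {ae P, forall w, (limn_esup (fun n => (regret pi i l n w)%:E) <= 0)%E}.
Proof.
have max_ae := br_maximizer_ae hF hi hl hvsfp.
have noise_ae := noise_sublinear_ae hF hi hl hind hvsfp.
apply: filterS2 max_ae noise_ae => w max_w noise_w.
apply: limn_esup_le0 => eps e0.
have b1 := beta_gt0 1%N (leqnn 1).
set x1 := br pi rho beta l 1 w.
have [x1i x1max] := max_w 1%N isT; rewrite -/x1 in x1i x1max.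
have ys : simplex (mean_action l 1 w : 'rV[R]_k.+1) by exact: mean_action_simplex.
(* The maximizer at time 1 bounds [rho] from above: at any interior point, the gain in
   [rho / beta 1] is at most the loss in payoff, hence at most twice the payoff bound. *)
pose M0 := beta 1%N * (2 * payoff_bound pi) + rho x1.
have rhoM0 e : simplex_int e -> rho e <= M0.
  move=> ei; have := x1max e ei.
  have es : simplex e by case: ei.
  have xs : simplex x1 by case: x1i.
  have := payoff_simplex_bound pi es ys; have := payoff_simplex_bound pi xs ys.
  rewrite !ler_norml => /andP[_ h1] /andP[h2 _] h3.
  have : (beta 1%N)^-1 * (rho e - rho x1) <= 2 * payoff_bound pi.
    by rewrite mulrBr; lra.
  by rewrite ler_pdivrMl // /M0; lra.
exact: (regret_eventually_le hrho beta_gt0 beta_nd beta_oo rhoM0 beta_le max_w noise_w).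
Qed.
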